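(* Let $p\in\mathbb{S}^2$. There exist constants $A,B>0$ such that for every $f\in H^1(\mathbb{S}^2)$ (with $A,B$ independent of $f$) $$Q(f;\phi)\le T_A(f)\qquad\text{and}\qquad Q(f;\psi)\le T_B(f).$$
   Context: $\mathbb{S}^2\subset\mathbb{R}^3$ is the unit sphere with its surface measure $\sigma$ (in spherical coordinates $d\sigma=\sin\theta\,d\theta\,d\varphi$), $\nabla$ is the (weak) gradient on $\mathbb{S}^2$, and $d(x,p)\in[0,\pi]$ is the geodesic distance from $x$ to the fixed point $p$. $H^1(\mathbb{S}^2)$ is the real Sobolev space obtained as the completion of $C^\infty(\mathbb{S}^2)$ in the norm $\left(\|f\|_{L^2}^2+\|\nabla f\|_{L^2}^2\right)^{1/2}$; equivalently, the functions in $L^2(\mathbb{S}^2)$ whose weak gradient is in $L^2$. For $t\in(0,\pi]$ put $\phi(t)=\log(\pi e/t)$, and for $t\in(0,\pi)$ put $\psi(t)=\phi(\sin t)=\log(\pi e/\sin t)$. For $\chi\in\{\phi,\psi\}$ let $\rho_\chi(t)=t\,\chi(t)$ and $$Q(f;\chi)=\frac14\int_{\mathbb{S}^2}\left(\frac{f(x)^2}{\rho_\chi(d(x,p))^2}+\frac{f(x)^2}{\rho_\chi(\pi-d(x,p))^2}\right)d\sigma(x)$$ (the integrand is defined off the two points $p$ and $-p$, which have measure zero). For a constant $C>0$ let $$T_C(f)=\int_{\mathbb{S}^2}|\nabla f|^2\,d\sigma+\frac{C}{4}\int_{\mathbb{S}^2}f^2\,d\sigma.$$ *)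

(* Defs.v *)
From HB Require Import structures.
From mathcomp Require Import all_boot all_order all_algebra.
From mathcomp Require Import all_classical all_reals all_analysis.
From mathcomp Require Import measurable_realfun.

Set Implicit Arguments.
Unset Strict Implicit.
Unset Printing Implicit Defensive.

Import Order.TTheory GRing.Theory Num.Theory.
Import numFieldNormedType.Exports.

Local Open Scope classical_set_scope.
Local Open Scope ring_scope.

(* The library norm of this product is the sup norm: Euclidean quantities go
   through [dot]. *)
Notation E3 R := (R * R * R)%type.

Section sphere.
Context {R : realType}.
Implicit Types (x y p : E3 R) (t C : R) (f F : E3 R -> R) (G : E3 R -> E3 R).

Definition dot x y : R := x.1.1 * y.1.1 + x.1.2 * y.1.2 + x.2 * y.2.

Definition S2 : set (E3 R) := [set x | dot x x = 1].

Definition geod x p : R := acos (dot x p).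

Definition sph (u : measurableTypeR R * measurableTypeR R) : E3 R :=
  (sin u.1 * cos u.2, sin u.1 * sin u.2, cos u.1).

Definition sph_box : set (measurableTypeR R * measurableTypeR R) :=
  `[0, pi] `*` `[0, pi *+ 2].

(* As a Borel measure on R^3, carried by S2. *)
Definition sigma (A : set (E3 R)) : \bar R :=
  (\int[lebesgue_measure \x lebesgue_measure]_(u in sph @^-1` A `&` sph_box)
     (sin u.1)%:E)%E.

Lemma measurable_sph : measurable_fun setT sph.
Proof.
have m1 (g : R -> R) : continuous g -> measurable_fun setT
    (fun u : measurableTypeR R * measurableTypeR R => g u.1).
  move=> cg; apply: (@measurableT_comp _ _ _ _ _ _ (g : measurableTypeR R -> R)).
    exact: continuous_measurable_fun.
  exact: measurable_fst.
have m2 (g : R -> R) : continuous g -> measurable_fun setT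
    (fun u : measurableTypeR R * measurableTypeR R => g u.2).
  move=> cg; apply: (@measurableT_comp _ _ _ _ _ _ (g : measurableTypeR R -> R)).
    exact: continuous_measurable_fun.
  exact: measurable_snd.
have [cs cc] := (@continuous_sin R, @continuous_cos R).
apply/measurable_fun_pairP; split; last exact: m1.
by apply/measurable_fun_pairP; split; apply: measurable_funM;
  first [exact: m1 | exact: m2].
Qed.

Lemma measurable_sph_box : measurable sph_box.
Proof. by apply: measurableX; exact: measurable_itv. Qed.

Let sphI (A : set (E3 R)) : measurable A -> measurable (sph @^-1` A `&` sph_box).
Proof.
move=> mA; apply: measurableI; last exact: measurable_sph_box.
by rewrite -[X in measurable X]setTI; exact: measurable_sph.
Qed.

Let sin_ge0 (A : set (E3 R)) u :
  (sph @^-1` A `&` sph_box) u -> (0 <= (sin u.1)%:E :> \bar R)%E.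
Proof.
case=> _ [/= + _]; rewrite in_itv/= => u1.
by rewrite lee_fin sin_ge0_pi.
Qed.

Let sigma0 : sigma set0 = 0%E.
Proof. by rewrite /sigma preimage_set0 set0I integral_set0. Qed.

Let sigma_ge0 A : (0 <= sigma A)%E.
Proof. by apply: integral_ge0 => u; exact: sin_ge0. Qed.

Let sigma_additive : semi_sigma_additive sigma.
Proof.
move=> A mA tA mUA; rewrite /sigma preimage_bigcup setI_bigcupl.
rewrite ge0_integral_bigcup//=.
- by apply: is_cvg_ereal_nneg_natsum_cond => n _ _; exact: sigma_ge0.
- by move=> k; exact: sphI.
- apply/measurable_EFinP; apply: measurable_funTS.
  apply: (@measurableT_comp _ _ _ _ _ _ (sin : measurableTypeR R -> R)).
    by apply: continuous_measurable_fun; exact: continuous_sin.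
  exact: measurable_fst.
- by move=> u [k _]; exact: sin_ge0.
- apply/trivIsetP => i j _ _ ij; apply/seteqP; split => // u [[/= ui _] [uj _]].
  by have /trivIsetP/(_ i j I I ij)/seteqP[+ _] := tA; apply; split; eauto.
Qed.

HB.instance Definition _ := isMeasure.Build _ _ _ sigma
  sigma0 sigma_ge0 sigma_additive.

(* C^oo on R^3: every iterated directional derivative exists and is
   differentiable.  Since S2 is a closed submanifold of R^3, C^oo(S2) is the set
   of restrictions to S2 of such functions. *)
Definition smooth F : Prop := forall (s : seq (E3 R)) x,
  differentiable (foldr (fun v (g : E3 R -> R) y => 'D_v g y) F s) x.

Definition grad F x : E3 R :=
  ('D_(1, 0, 0) F x, 'D_(0, 1, 0) F x, 'D_(0, 0, 1) F x).

(* At x in S2, the tangential part of the Euclidean gradient: it depends only on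
   the restriction of F to S2, and is the gradient of that restriction. *)
Definition sgrad F x : E3 R := grad F x - dot (grad F x) x *: x.

Definition int_sq f : \bar R := (\int[sigma]_(x in S2) (f x ^+ 2)%:E)%E.

Definition int_normsq G : \bar R := (\int[sigma]_(x in S2) (dot (G x) (G x))%:E)%E.

(* f is in H^1(S2) and G is its weak gradient.  The completion of C^oo(S2) in the
   H^1 norm is realized as the closure of the pairs (F, sgrad F) in
   L^2(S2) x L^2(S2; R^3); the weak gradient is the second component, i.e. the
   continuous extension of the classical gradient.  Functions are total on R^3,
   but only their values on S2 matter. *)
Definition H1 f G : Prop :=
  [/\ measurable_fun S2 f /\ (int_sq f < +oo)%E,
      measurable_fun S2 G /\ (int_normsq G < +oo)%E &
      exists F : nat -> E3 R -> R,
        [/\ forall n, smooth (F n),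
            int_sq (F n \- f) @[n --> \oo] --> 0%E &
            int_normsq (fun x => sgrad (F n) x - G x) @[n --> \oo] --> 0%E]].

Definition phi t : R := ln (pi * expR 1 / t).

Definition psi t : R := phi (sin t).

Definition rho (chi : R -> R) t : R := t * chi t.

(* The two points where the integrand is undefined are removed from the domain;
   values in \bar R, so that an upper bound includes convergence. *)
Definition Q p f (chi : R -> R) : \bar R :=
  ((4^-1)%:E * \int[sigma]_(x in S2 `\` [set p; (- p)%R])
     (f x ^+ 2 / rho chi (geod x p) ^+ 2 +
      f x ^+ 2 / rho chi (pi - geod x p) ^+ 2)%:E)%E.

Definition T C f G : \bar R := (int_normsq G + (C / 4)%:E * int_sq f)%E.

End sphere.

(* Main.v *)
Require Import Defs.
From mathcomp Require Import all_boot all_order all_algebra.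
From mathcomp Require Import all_classical all_reals all_analysis.
From mathcomp Require Import measurable_realfun ring lra.

(** The inequality is a critical Hardy inequality with the sharp constant, and it
    follows from a vector field with the right divergence.  Expanding the square
    |grad F + F X|^2 >= 0 for a tangential field X and integrating <grad (F^2), X>
    by parts gives, for smooth F on the sphere,
      int |grad F|^2 >= int F^2 (div X - |X|^2),
    so that a field with div X - |X|^2 >= W - 5/2, where W is at least
    (1 / rho(r)^2 + 1 / rho(pi - r)^2) / 4 at distance r from p, proves the claim for
    smooth F with A = 10.

    In the plane, the ground state sqrt (log (c / r)) of the critical Hardy operator
    suggests X = grad r / (2 r log (c / r)).  On the sphere it pays to replace r by
    u = 1 - <x,p> = 1 - cos r, which behaves like r^2 / 2 and is smooth.  With
      v = u + e,  l(v) = ln (2 e^2 / v)  (here e^2 is the square of Euler's number),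
      X_p = - grad <x,p> / (2 v l(v)),
    a computation gives
      div X_p - |X_p|^2 >= u / (2 v^2 l(v)^2) - 5/4,
    and e > 0 makes everything smooth.  The field used is X_p + X_(-p): the two
    summands point in opposite directions, so that the cross term in |X|^2 has
    the favourable sign ([field_coef_ineq]).

    The factor 2 e^2 is chosen such that no constant is lost against the weight of the
    theorem: by sin (r/2) <= r/2 and the Jordan inequality sin (r/2) >= r / pi one has
    2 u <= r^2 and l(u) <= 2 log (pi e / r), hence
    1 / (4 rho(r)^2) <= 1 / (2 u l(u)^2) on the whole of ]0, pi[
    ([inv_rho_phi_le]).  The weight of psi is smaller than that of phi because
    sin r <= r, so the same constant serves for both.

    As p is arbitrary while the measure is given in coordinates attached to a fixed
    pole, the integration by parts must hold for fields that are not aligned with the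
    coordinates.  For a field k(x) (p - <x,p> x), the divergence times
    sin theta is the sum of a theta-derivative of a function that vanishes at both
    poles and of a phi-derivative of a periodic function, so it integrates
    to zero by Fubini and the fundamental theorem of calculus
    ([integral_sphere_div]).

    For fixed e > 0 the weight is bounded, so the inequality passes from smooth
    functions to H^1 ([hardy_H1]); Fatou's lemma then removes e ([Q_le]). *)

Set Implicit Arguments.
Unset Strict Implicit.
Unset Printing Implicit Defensive.

Import Order.TTheory GRing.Theory Num.Theory.
Import numFieldNormedType.Exports.

Local Open Scope classical_set_scope.
Local Open Scope ring_scope.

(** * Pointwise calculus rules *)

Section calculus.
Context {R : realType}.

Lemma is_derive_add (f g : R -> R) x df dg : is_derive x (1:R) f df ->
  is_derive x (1:R) g dg ->
  is_derive x (1:R) (fun t => f t + g t) (df + dg).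
Proof. by move=> ? ?; exact: is_deriveD. Qed.

Lemma is_derive_opp (f : R -> R) x df : is_derive x (1:R) f df ->
  is_derive x (1:R) (fun t => - f t) (- df).
Proof. by move=> ?; exact: is_deriveN. Qed.

Lemma is_derive_mul (f g : R -> R) x df dg : is_derive x (1:R) f df ->
  is_derive x (1:R) g dg ->
  is_derive x (1:R) (fun t => f t * g t) (df * g x + f x * dg).
Proof.
move=> hf hg; have := is_deriveM hf hg.
by rewrite /= addrC /GRing.scale/= [g x * _]mulrC.
Qed.

Lemma is_derive_const (c : R) x : is_derive x (1:R) (fun=> c) 0.
Proof. exact: is_derive_cst. Qed.

Lemma is_derive_inv (f : R -> R) x df : f x != 0 -> is_derive x (1:R) f df ->
  is_derive x (1:R) (fun t => (f t)^-1) (- (f x) ^- 2 * df).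
Proof.
move=> f0 h; apply: DeriveDef; first exact: derivableV.
by rewrite deriveV// derive_val.
Qed.

Lemma continuous_at_add (T : topologicalType) (f g : T -> R) x :
  {for x, continuous f} ->
  {for x, continuous g} -> {for x, continuous (fun t => f t + g t)}.
Proof. by move=> cf cg; exact: continuousD. Qed.

Lemma continuous_at_sub (T : topologicalType) (f g : T -> R) x :
  {for x, continuous f} ->
  {for x, continuous g} -> {for x, continuous (fun t => f t - g t)}.
Proof. by move=> cf cg; exact: continuousB. Qed.

Lemma continuous_at_mul (T : topologicalType) (f g : T -> R) x :
  {for x, continuous f} ->
  {for x, continuous g} -> {for x, continuous (fun t => f t * g t)}.
Proof. by move=> cf cg; exact: continuousM. Qed.

Lemma continuous_pair (U V W : topologicalType) (f : U -> V) (g : U -> W) x :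
  {for x, continuous f} -> {for x, continuous g} ->
  {for x, continuous (fun t => (f t, g t))}.
Proof. by move=> cf cg; exact: (cvg_pair cf cg). Qed.

(** The curve is given by its components, so that the elementary rules apply to
    each of them and no product-space differential has to be computed by hand. *)
Lemma is_derive_along (k : E3 R -> R) (c1 c2 c3 : R -> R) t d1 d2 d3 :
  is_derive t (1:R) c1 d1 -> is_derive t (1:R) c2 d2 -> is_derive t (1:R) c3 d3 ->
  differentiable k (c1 t, c2 t, c3 t) ->
  is_derive t (1:R) (fun t => k (c1 t, c2 t, c3 t))
    ('d k (c1 t, c2 t, c3 t) (d1, d2, d3)).
Proof.
move=> h1 h2 h3 dk.
have diff (c : R -> R) d : is_derive t (1:R) c d -> is_diff t c ( *:%R^~ d).
  move=> h; have dc : derivable c t 1 by exact: ex_derive.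
  apply: DiffDef; first exact/derivable1_diffP.
  by rewrite deriv1E// derive1E derive_val.
have /diff i1 := h1; have /diff i2 := h2; have /diff i3 := h3.
pose c t := (c1 t, c2 t, c3 t).
have dc : is_diff t c (fun y => (y *: d1, y *: d2, y *: d3)).
  exact: is_diff_pair.
have dkc : differentiable (k \o c) t by apply: differentiable_comp.
apply: DeriveDef; first exact: diff_derivable.
rewrite deriveE// diff_comp//= /comp/= (diff_val (f:=c)).
by rewrite !scale1r.
Qed.

End calculus.

(** * Dot product and unit vectors *)

Section dot_product.
Context {R : realType}.

Lemma dotC (x y : E3 R) : dot x y = dot y x.
Proof. by rewrite /dot; ring. Qed.

Lemma dot_ge0 (x : E3 R) : 0 <= dot x x.
Proof. by rewrite /dot !addr_ge0// -expr2 sqr_ge0. Qed.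

Lemma dotDl (a b c : E3 R) : dot (a + b) c = dot a c + dot b c.
Proof. by rewrite /dot/=; ring. Qed.

Lemma dotBl (a b c : E3 R) : dot (a - b) c = dot a c - dot b c.
Proof. by rewrite /dot/=; ring. Qed.

Lemma dotZl (a c : E3 R) r : dot (r *: a) c = r * dot a c.
Proof. by rewrite /dot/= /GRing.scale/=; ring. Qed.

Lemma dotDZ (a b : E3 R) (r : R) :
  dot (a + r *: b) (a + r *: b) = dot a a + 2 * r * dot a b + r ^+ 2 * dot b b.
Proof. by rewrite /dot/= /GRing.scale/=; ring. Qed.

Lemma sph_S2 u : S2 (@sph R u).
Proof.
rewrite /S2 /sph /dot /=.
have := cos2Dsin2 u.1; have := cos2Dsin2 u.2.
rewrite -!expr2 !exprMn => h2 h1.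
by rewrite -mulrDr h2 mulr1 addrC.
Qed.

Lemma dot_S2_bound (x p : E3 R) : S2 x -> S2 p -> -1 <= dot x p <= 1.
Proof.
rewrite /S2/= => hx hp.
have := dot_ge0 (x + 1 *: p); have := dot_ge0 (x + (-1) *: p).
rewrite !dotDZ hx hp; lra.
Qed.

(** Equality case of Cauchy-Schwarz: |x - p|^2 = 2 - 2 <x,p>. *)
Lemma dot_S2_eq1 (x p : E3 R) : S2 x -> S2 p -> dot x p = 1 -> x = p.
Proof.
case: x => [[x1 x2] x3]; case: p => [[p1 p2] p3]; rewrite /S2 /dot/= => hx hp h.
have e : (x1 - p1) ^+ 2 + (x2 - p2) ^+ 2 + (x3 - p3) ^+ 2 = 0.
  transitivity ((x1 * x1 + x2 * x2 + x3 * x3) + (p1 * p1 + p2 * p2 + p3 * p3)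
    - 2 * (x1 * p1 + x2 * p2 + x3 * p3)); first ring.
  by rewrite hx hp h; ring.
have [s1 [s2 s3]] := (sqr_ge0 (x1 - p1), (sqr_ge0 (x2 - p2), sqr_ge0 (x3 - p3))).
have z (a b : R) : (a - b) ^+ 2 = 0 -> a = b.
  by move/eqP; rewrite sqrf_eq0 subr_eq0 => /eqP.
congr ((_, _), _); apply: z; lra.
Qed.

Lemma diff_grad (F : E3 R -> R) x v : differentiable F x ->
  'd F x v = dot (grad F x) v.
Proof.
move=> dF; rewrite /grad /dot /= !deriveE//.
case: v => [[v1 v2] v3] /=.
have -> : (v1, v2, v3) = v1 *: ((1, 0, 0) : E3 R) + v2 *: ((0, 1, 0) : E3 R)
  + v3 *: ((0, 0, 1) : E3 R).
  by rewrite /GRing.scale/=; congr ((_, _), _) => /=; rewrite /GRing.scale/=; ring.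
rewrite !linearD !linearZ /= /GRing.scale/=; ring.
Qed.

Lemma continuous_dot (T : topologicalType) (G H : T -> E3 R) (x : T) :
  {for x, continuous G} -> {for x, continuous H} ->
  {for x, continuous (fun t => dot (G t) (H t))}.
Proof.
have c1 (F : T -> E3 R) : {for x, continuous F} ->
  {for x, continuous (fun t => (F t).1.1)}.
  move=> cF; apply: (@continuous_comp _ _ _ F (fun y => y.1.1)) => //.
  by apply: (@continuous_comp _ _ _ fst fst); exact: cvg_fst.
have c2 (F : T -> E3 R) : {for x, continuous F} ->
  {for x, continuous (fun t => (F t).1.2)}.
  move=> cF; apply: (@continuous_comp _ _ _ F (fun y => y.1.2)) => //.
  by apply: (@continuous_comp _ _ _ fst snd); [exact: cvg_fst|exact: cvg_snd].
have c3 (F : T -> E3 R) : {for x, continuous F} ->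
  {for x, continuous (fun t => (F t).2)}.
  move=> cF; apply: (@continuous_comp _ _ _ F (fun y => y.2)) => //.
  exact: cvg_snd.
move=> cG cH; rewrite /dot; apply: continuousD; first apply: continuousD.
- by apply: continuousM; exact: c1.
- by apply: continuousM; exact: c2.
- by apply: continuousM; exact: c3.
Qed.

Lemma measurable_fun_dot d (T : measurableType d) (D : set T) (G H : T -> E3 R) :
  measurable_fun D G -> measurable_fun D H ->
  measurable_fun D (fun x => dot (G x) (H x)).
Proof.
have p1 : measurable_fun setT (fun x : E3 R => x.1.1).
  by apply: measurableT_comp; [exact: measurable_fst|exact: measurable_fst].
have p2 : measurable_fun setT (fun x : E3 R => x.1.2).
  by apply: measurableT_comp; [exact: measurable_snd|exact: measurable_fst].
have p3 : measurable_fun setT (fun x : E3 R => x.2) by exact: measurable_snd.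
move=> mG mH; rewrite /dot.
by apply: measurable_funD; [apply: measurable_funD|];
  apply: measurable_funM;
  do [exact: (measurableT_comp p1)|exact: (measurableT_comp p2)|
      exact: (measurableT_comp p3)].
Qed.

Lemma measurable_dot (p : E3 R) : measurable_fun setT (fun x : E3 R => dot x p).
Proof. by apply: measurable_fun_dot. Qed.

Lemma measurable_S2 : measurable (@S2 R).
Proof.
have -> : @S2 R = setT `&` (fun x : E3 R => dot x x) @^-1` [set 1] by rewrite setTI.
by apply: measurable_fun_dot.
Qed.

End dot_product.

(** * Measurability of functions of several variables *)

Section several_variables.
Context {R : realType}.

(** Rounding the second variable down to the grid of step 1 / (n + 1) makes
    f a countable gluing of measurable functions of the first variable, and
    continuity in the second variable makes these approximations converge. This gives
    the measurability of continuous functions for the product sigma-algebra. *)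
Lemma measurable_fun_caratheodory d (T : measurableType d) (f : T * R -> R) :
  (forall y, measurable_fun setT (fun x => f (x, y))) ->
  (forall x, continuous (fun y => f (x, y))) ->
  measurable_fun setT f.
Proof.
move=> mf cf.
pose q (n : nat) (y : R) : R := (Num.floor (y * n.+1%:R))%:~R / n.+1%:R.
apply: (@measurable_fun_cvg _ _ _ _ (fun n z => f (z.1, q n z.2))); last first.
- move=> [x y] _ /=.
  apply: (@cvg_comp _ _ _ (q ^~ y) (fun y => f (x, y)) _ (nbhs y)); last exact: cf.
  apply/cvgrPdist_le => e e0; near=> n.
  have n0 : (0 < n.+1%:R :> R) by rewrite ltr0n.
  rewrite /q -(ler_pM2r n0) -[X in _ * X <= _](gtr0_norm n0) -normrM mulrBl.
  rewrite mulfVK ?gt_eqF//.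
  have /andP[h1 h2] := floor_itv (y * n.+1%:R).
  rewrite ger0_norm ?subr_ge0//.
  apply: (@le_trans _ _ 1).
    by rewrite lerBlDl; move: h2; rewrite intrD => /ltW.
  rewrite mulrC -ler_pdivrMl// mulr1.
  by apply: ltW; near: n; exact: (near_infty_natSinv_lt (PosNum e0)).
- move=> n; have n0 : (0 < n.+1%:R :> R) by rewrite ltr0n.
  move=> _ B mB; rewrite setTI.
  have -> : (fun z => f (z.1, q n z.2)) @^-1` B = \bigcup_(k in [set: int])
     ((fun x => f (x, k%:~R / n.+1%:R)) @^-1` B `*`
      `[k%:~R / n.+1%:R, (k + 1)%:~R / n.+1%:R[).
    apply/seteqP; split=> [[x y]/= Bxy|[x y] [k _] [/= Bx]].
      exists (Num.floor (y * n.+1%:R)) => //; split => //=.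
      rewrite in_itv/= ler_pdivrMr// ltr_pdivlMr//.
      exact: floor_itv.
    rewrite in_itv/= ler_pdivrMr// ltr_pdivlMr// => /floor_def yk.
    by rewrite /q yk.
  apply: countable_bigcupT_measurable => // k.
  apply: measurableX; last exact: measurable_itv.
  by rewrite -[X in measurable X]setTI; exact: mf.
Unshelve. all: by end_near. Qed.

Lemma continuous_measurable_R2 (g : R * R -> R) : continuous g ->
  measurable_fun setT (g : measurableTypeR R * measurableTypeR R -> R).
Proof.
move=> cg; apply: measurable_fun_caratheodory => [y|x].
  apply: continuous_measurable_fun => x.
  apply: (@continuous_comp _ _ _ (fun x => (x, y)) g); last exact: cg.
  by apply: continuous_pair; [exact: cvg_id|exact: cst_continuous].
move=> y; apply: (@continuous_comp _ _ _ (fun y => (x, y)) g); last exact: cg.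
by apply: continuous_pair; [exact: cst_continuous|exact: cvg_id].
Qed.

Lemma continuous_measurable_R3 (g : E3 R -> R) : continuous g ->
  measurable_fun setT g.
Proof.
move=> cg; apply: (@measurable_fun_caratheodory _ (R * R)%type g) => [z|xy].
  apply: (@continuous_measurable_R2 (fun xy => g (xy, z))) => xy.
  apply: (@continuous_comp _ _ _ (fun xy => (xy, z)) g); last exact: cg.
  by apply: continuous_pair; [exact: cvg_id|exact: cst_continuous].
move=> z; apply: (@continuous_comp _ _ _ (fun z => (xy, z)) g); last exact: cg.
by apply: continuous_pair; [exact: cst_continuous|exact: cvg_id].
Qed.

End several_variables.

(** * Integrals over the sphere in spherical coordinates *)

Section spherical_coordinates.
Context {R : realType}.
Let lam := @lebesgue_measure R.
Let lam2 := (lam \x lam)%E.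
Import HBNNSimple.
Local Open Scope ereal_scope.

Lemma measurable_sin_fst (D : set (measurableTypeR R * measurableTypeR R)) :
  measurable_fun D (fun u => sin u.1).
Proof.
apply: measurable_funTS.
apply: (@measurableT_comp _ _ _ _ _ _ (sin : measurableTypeR R -> R)).
  by apply: continuous_measurable_fun; exact: continuous_sin.
exact: measurable_fst.
Qed.

Lemma sph_box_sin_ge0 (u : measurableTypeR R * measurableTypeR R) : sph_box u ->
  (0 <= sin u.1)%R.
Proof. by case=> /= + _; rewrite in_itv/= => u1; rewrite sin_ge0_pi. Qed.

Lemma sigma_indic (A : set (E3 R)) :
  sigma A = \int[lam2]_(u in sph_box) ((\1_A (sph u))%:E * (sin u.1)%:E).
Proof.
rewrite /sigma integral_mkcondl; apply: eq_integral => u _.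
rewrite patchE indicE; have -> : (u \in @sph R @^-1` A) = (sph u \in A) by [].
by case: ifP; rewrite ?mul1e ?mul0e.
Qed.

(** The measure is the image under [sph] of the density sin theta, by definition on
    indicators; simple functions and monotone convergence do the rest. *)
Lemma ge0_integral_sigma (f : E3 R -> \bar R) : measurable_fun setT f ->
  (forall x, 0 <= f x) ->
  \int[sigma]_x f x = \int[lam2]_(u in sph_box) (f (sph u) * (sin u.1)%:E).
Proof.
move=> mf f0.
have mB := @measurable_sph_box R.
have mS : measurable_fun sph_box (@sph R) by apply: measurable_funTS;
  exact: measurable_sph.
have msin : measurable_fun (@sph_box R) (fun u => (sin u.1)%:E).
  by apply/measurable_EFinP; exact: measurable_sin_fst.
pose f_ := nnsfun_approx measurableT mf.
have cf x : (f_ n x)%:E @[n --> \oo] --> f x.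
  by apply: cvg_nnsfun_approx => //.
transitivity (limn (fun n => \int[sigma]_x (f_ n x)%:E)).
  rewrite -monotone_convergence//.
  - by apply: eq_integral => x _; apply/esym/cvg_lim => //; exact: cf.
  - by move=> n; exact/measurable_EFinP/measurable_funP.
  - by move=> n y _; rewrite lee_fin.
  - by move=> y _ m n mn; rewrite lee_fin; exact/lefP/nd_nnsfun_approx.
rewrite [X in limn X](_ : _ =
    (fun n => \int[lam2]_(u in sph_box) ((f_ n (sph u))%:E * (sin u.1)%:E))).
  rewrite -monotone_convergence//.
  - apply: eq_integral => u /[!inE] uB; apply/cvg_lim => //.
    by apply: cvgeZr => //; exact: cf.
  - move=> n; apply: emeasurable_funM => //; apply/measurable_EFinP.
    by apply: measurableT_comp => //; exact: measurable_funP.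
  - by move=> n u /sph_box_sin_ge0 s0; rewrite mule_ge0// lee_fin.
  - move=> u /sph_box_sin_ge0 s0 m n mn; rewrite lee_wpmul2r ?lee_fin//.
    exact/lefP/nd_nnsfun_approx.
apply/funext => n; rewrite integralT_nnsfun sintegralE.
under [RHS]eq_integral => u uB.
  rewrite fimfunE -fsumEFin//= ge0_mule_fsuml; last first.
    by move=> r; rewrite lee_fin; exact: nnfun_muleindic_ge0.
  over.
rewrite ge0_integral_fsum//.
- apply: eq_fsbigr => r /[!inE] -[y _ <-].
  rewrite -[X in _ * X]/(sigma _) sigma_indic -ge0_integralZl//.
  + by apply: eq_integral => u _; rewrite EFinM muleA.
  + apply: emeasurable_funM => //; apply/measurable_EFinP.
    by apply: (measurableT_comp (measurable_indic _)).
  + by move=> u /sph_box_sin_ge0 s0; rewrite mule_ge0// lee_fin.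
  + by rewrite lee_fin.
- move=> r; apply: emeasurable_funM => //; apply/measurable_EFinP.
  apply: measurable_funM => //.
  by apply: (measurableT_comp (measurable_indic _)).
- move=> r u /sph_box_sin_ge0 s0; rewrite mule_ge0 ?lee_fin//.
  exact: nnfun_muleindic_ge0.
Qed.

Lemma ge0_integral_S2 (f : E3 R -> \bar R) : measurable_fun S2 f ->
  (forall x, S2 x -> 0 <= f x) ->
  \int[sigma]_(x in S2) f x = \int[lam2]_(u in sph_box) (f (sph u) * (sin u.1)%:E).
Proof.
move=> mf f0; rewrite integral_mkcond ge0_integral_sigma.
- by apply: eq_integral => u _; rewrite patchE mem_set//; exact: sph_S2.
- by apply/(measurable_restrictT _ _).1 => //; exact: measurable_S2.
- by move=> x; apply: erestrict_ge0.
Qed.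

End spherical_coordinates.

(** * Derivatives of periodic functions integrate to zero *)

Section box_integrals.
Context {R : realType}.
Let lam := @lebesgue_measure R.
Let lam2 := (lam \x lam)%E.

Lemma sph_box_finite : (lam2 (@sph_box R) < +oo)%E.
Proof.
rewrite /lam2 /sph_box product_measure1E//.
rewrite /lam /= !lebesgue_measure_itv/=.
by do 2 case: ifP => _; rewrite ?mule0 ?mul0e// -?EFinD -?EFinM ltry.
Qed.

Lemma continuous_integrable_sph_box (g : R * R -> R) : continuous g ->
  lam2.-integrable sph_box (EFin \o (g : measurableTypeR R * measurableTypeR R
    -> R)).
Proof.
move=> cg; apply: measurable_bounded_integrable.
- exact: measurable_sph_box.
- exact: sph_box_finite.
- by apply: measurable_funTS; exact: continuous_measurable_R2.
- have cB : compact (`[0, pi]%classic `*` `[0, pi *+ 2]%classic : set (R * R)).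
    by apply: compact_setX; exact: segment_compact.
  have : compact (g @` (`[0, pi]%classic `*` `[0, pi *+ 2]%classic)).
    by apply: continuous_compact => //; exact: continuous_subspaceT.
  move=> /compact_bounded [M [Mr HM]]; exists M; split => // x Mx y By.
  by apply: HM => //; exists y.
Qed.

Let int_box (a : R * R -> R) : continuous a ->
  lam2.-integrable setT ((EFin \o (a : measurableTypeR R * measurableTypeR R ->
    R)) \_ sph_box).
Proof.
move=> ca; apply/(integrable_mkcond _ _).1; first exact: measurable_sph_box.
exact: continuous_integrable_sph_box.
Qed.

Lemma integral_derive_periodic (a A : R -> R) (l : R) : 0 < l -> continuous a ->
  (forall x : R, is_derive x 1 A (a x)) -> A 0 = A l ->
  (\int[lam]_(x in `[0%R, l]) (a x)%:E = 0)%E.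
Proof.
move=> l0 ca dA A0.
have cA : continuous A.
  by move=> x; apply: differentiable_continuous; apply/derivable1_diffP;
    exact: ex_derive.
rewrite (@continuous_FTC2 _ a A)//.
- by rewrite A0 subee.
- exact: continuous_subspaceT.
- split.
  + by move=> x _; exact: ex_derive.
  + by apply: cvg_at_right_filter; exact: cA.
  + by apply: cvg_at_left_filter; exact: cA.
- by move=> x _; rewrite derive1E derive_val.
Qed.

(** Fubini, integrating first along the meridians. *)
Lemma integral_box_fst (a : R * R -> R) (A : R -> R -> R) : continuous a ->
  (forall y x : R, is_derive x 1 (A ^~ y) (a (x, y))) ->
  (forall y, A 0 y = A pi y) ->
  (\int[lam2]_(u in sph_box) (a u)%:E = 0)%E.
Proof.
move=> ca dA A0.
rewrite integral_mkcond -(integral21_prod_meas1 (int_box ca)).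
apply: integral0_eq => y _.
have [yB|yB] := boolP (y \in `[0, pi *+ 2]); last first.
  apply: integral0_eq => x _; rewrite patchE memNset// /sph_box => -[_ /=].
  by apply/negP.
transitivity (\int[lam]_(x in `[0%R, (pi:R)%R]) (a (x, y))%:E)%E; last first.
  apply: (@integral_derive_periodic _ (A ^~ y)) => //; first exact: pi_gt0.
  move=> x; apply: (@continuous_comp _ _ _ (fun x => (x, y)) a); last exact: ca.
  by apply: continuous_pair; [exact: cvg_id|exact: cst_continuous].
rewrite [RHS]integral_mkcond; apply: eq_integral => x _.
have yB' : y \in `[0%R, (pi *+ 2 : R)]%classic by rewrite inE.
by rewrite !patchE /sph_box in_setX/= yB' andbT.
Qed.

(** Fubini, integrating first along the parallels. *)
Lemma integral_box_snd (a : R * R -> R) (A : R -> R -> R) : continuous a ->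
  (forall x y : R, is_derive y 1 (A x) (a (x, y))) ->
  (forall x, A x 0 = A x (pi *+ 2)) ->
  (\int[lam2]_(u in sph_box) (a u)%:E = 0)%E.
Proof.
move=> ca dA A0.
rewrite integral_mkcond -(integral12_prod_meas1 (int_box ca)).
apply: integral0_eq => x _.
have [xB|xB] := boolP (x \in `[0, pi]); last first.
  apply: integral0_eq => y _; rewrite patchE memNset// /sph_box => -[/= + _].
  by apply/negP.
transitivity (\int[lam]_(y in `[0%R, (pi *+ 2 : R)%R]) (a (x, y))%:E)%E; last first.
  apply: (@integral_derive_periodic _ (A x)) => //.
    by rewrite pmulrn_rgt0// pi_gt0.
  move=> y; apply: (@continuous_comp _ _ _ (fun y => (x, y)) a); last exact: ca.
  by apply: continuous_pair; [exact: cst_continuous|exact: cvg_id].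
rewrite [RHS]integral_mkcond; apply: eq_integral => y _.
have xB' : x \in `[0%R, (pi : R)]%classic by rewrite inE.
by rewrite !patchE /sph_box in_setX/= xB'.
Qed.

End box_integrals.

(** * The divergence theorem on the sphere *)

Section divergence.
Context {R : realType}.
Let lam := @lebesgue_measure R.
Let lam2 := (lam \x lam)%E.

(** The frame of unit vectors tangent to the meridians and to the parallels. *)
Definition e_theta (u : R * R) : E3 R :=
  (cos u.1 * cos u.2, cos u.1 * sin u.2, - sin u.1).

Definition e_phi (u : R * R) : E3 R := (- sin u.2, cos u.2, 0).

(** Parseval in the orthonormal frame e_theta, e_phi, [sph u]. *)
Lemma dot_frame (u : R * R) (v w : E3 R) :
  dot v (e_theta u) * dot w (e_theta u) + dot v (e_phi u) * dot w (e_phi u)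
  = dot v w - dot v (sph u) * dot w (sph u).
Proof.
have h1 := sin2cos2 u.1; have h2 := sin2cos2 u.2.
rewrite /dot /e_theta /e_phi /sph/=; ring: h1 h2.
Qed.

Let cont_fst (g : R -> R) : continuous g -> continuous (fun u : R * R => g u.1).
Proof.
move=> cg u; apply: (@continuous_comp _ _ _ fst g); last exact: cg.
exact: cvg_fst.
Qed.

Let cont_snd (g : R -> R) : continuous g -> continuous (fun u : R * R => g u.2).
Proof.
move=> cg u; apply: (@continuous_comp _ _ _ snd g); last exact: cg.
exact: cvg_snd.
Qed.

Lemma continuous_sph : continuous (@sph R : R * R -> E3 R).
Proof.
have [cs cc] := (@continuous_sin R, @continuous_cos R).
move=> u; apply: continuous_pair; first apply: continuous_pair.
- by apply: continuousM; [exact: cont_fst|exact: cont_snd].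
- by apply: continuousM; [exact: cont_fst|exact: cont_snd].
- exact: cont_fst.
Qed.

Let ce_theta : continuous (e_theta : R * R -> E3 R).
Proof.
have [cs cc] := (@continuous_sin R, @continuous_cos R).
move=> u; apply: (@continuous_pair (R * R)%type (R * R)%type R
  (fun u => (cos u.1 * cos u.2, cos u.1 * sin u.2)) (fun u => - sin u.1));
  first apply: continuous_pair.
- by apply: continuousM; [exact: cont_fst|exact: cont_snd].
- by apply: continuousM; [exact: cont_fst|exact: cont_snd].
- by apply: continuousN; exact: cont_fst.
Qed.

Let ce_phi : continuous (e_phi : R * R -> E3 R).
Proof.
have [cs cc] := (@continuous_sin R, @continuous_cos R).
move=> u; apply: (@continuous_pair (R * R)%type (R * R)%type R
  (fun u => (- sin u.2, cos u.2)) (fun u => 0)); first apply: continuous_pair.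
- by apply: continuousN; exact: cont_snd.
- exact: cont_snd.
- exact: cst_continuous.
Qed.

Lemma continuous_sin_fst : continuous (fun u : R * R => sin u.1).
Proof. by apply: cont_fst; exact: continuous_sin. Qed.

Let ccos : continuous (fun u : R * R => cos u.1).
Proof. by apply: cont_fst; exact: continuous_cos. Qed.

Section potential_field.
Context (p : E3 R) (k : E3 R -> R) (K : E3 R -> E3 R).

(* K is a gradient of k at the points of S2: asking for the chain rule along
   curves leaves k arbitrary away from the sphere. *)
Hypothesis dk : forall (c1 c2 c3 : R -> R) (t d1 d2 d3 : R),
  is_derive t (1:R) c1 d1 -> is_derive t (1:R) c2 d2 -> is_derive t (1:R) c3 d3 ->
  S2 (c1 t, c2 t, c3 t) ->
  is_derive t (1:R) (fun t => k (c1 t, c2 t, c3 t))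
    (dot (K (c1 t, c2 t, c3 t)) (d1, d2, d3)).
Hypothesis ck : forall x, S2 x -> {for x, continuous k}.
Hypothesis cK : forall x, S2 x -> {for x, continuous K}.

(** The theta-derivative of sin theta times the theta-component of the field
    k(x) (p - <x,p> x), written with K in place of the gradient of k. *)
Let divth (u : R * R) : R := cos u.1 * (k (sph u) * dot p (e_theta u)) +
   sin u.1 * (dot (K (sph u)) (e_theta u) * dot p (e_theta u)
     - k (sph u) * dot p (sph u)).

(** The phi-derivative of the phi-component of the same field.  The last bracket
    is minus the scalar product of p with the phi-derivative of e_phi. *)
Let divph (u : R * R) : R := dot (K (sph u)) (e_phi u) * sin u.1 * dot p (e_phi u)
   - k (sph u) * (sin u.1 * dot p (sph u) + cos u.1 * dot p (e_theta u)).

Let dth (y x : R) : is_derive x 1 (fun x =>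
  sin x * (k (sph (x, y)) * dot p (e_theta (x, y)))) (divth (x, y)).
Proof.
rewrite /e_theta /dot/=.
apply: is_derive_eq.
  apply: is_derive_mul; apply: is_derive_mul.
  apply: (@dk (fun x => sin x * cos y) (fun x => sin x * sin y) cos).
  exact: (sph_S2 (x, y)).
rewrite /GRing.scale /divth /= /dot /e_theta /sph/=; ring.
Qed.

Let dph (x y : R) : is_derive y 1 (fun y =>
  k (sph (x, y)) * dot p (e_phi (x, y))) (divph (x, y)).
Proof.
rewrite /e_phi /dot/=.
apply: is_derive_eq.
  apply: is_derive_mul.
  apply: (@dk (fun y => sin x * cos y) (fun y => sin x * sin y) (fun=> cos x)).
  exact: (sph_S2 (x, y)).
rewrite /GRing.scale /divph /= /dot /e_theta /e_phi /sph/=.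
(* e_phi differentiates to - sin theta N - cos theta e_theta. *)
rewrite -[X in _ + X = _]mulr1 -(cos2Dsin2 x); ring.
Qed.

Let cks : continuous (fun u : R * R => k (sph u)).
Proof.
move=> u; apply: (@continuous_comp _ _ _ (@sph R : R * R -> E3 R) k);
  first exact: continuous_sph.
exact: (ck (sph_S2 u)).
Qed.

Let cKs : continuous (fun u : R * R => K (sph u)).
Proof.
move=> u; apply: (@continuous_comp _ _ _ (@sph R : R * R -> E3 R) K);
  first exact: continuous_sph.
exact: (cK (sph_S2 u)).
Qed.

Let cp (G : R * R -> E3 R) : continuous G -> continuous (fun u => dot p (G u)).
Proof. by move=> cG u; apply: continuous_dot;
  [exact: cst_continuous|exact: cG]. Qed.

Let cdivth : continuous divth.
Proof.
rewrite /divth => u; apply: (@continuous_at_add R (R * R)%type).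
  apply: (@continuous_at_mul R (R * R)%type); first exact: ccos.
  by apply: (@continuous_at_mul R (R * R)%type); [exact: cks|exact: cp].
apply: (@continuous_at_mul R (R * R)%type); first exact: continuous_sin_fst.
apply: (@continuous_at_sub R (R * R)%type);
  apply: (@continuous_at_mul R (R * R)%type); [|exact: cp|exact: cks|].
  by apply: continuous_dot; [exact: cKs|exact: ce_theta].
by apply: cp; exact: continuous_sph.
Qed.

Let cdivph : continuous divph.
Proof.
rewrite /divph => u; apply: (@continuous_at_sub R (R * R)%type);
  apply: (@continuous_at_mul R (R * R)%type); [|exact: cp|exact: cks|].
  apply: (@continuous_at_mul R (R * R)%type); last exact: continuous_sin_fst.
  by apply: continuous_dot; [exact: cKs|exact: ce_phi].
apply: (@continuous_at_add R (R * R)%type);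
  apply: (@continuous_at_mul R (R * R)%type);
  [exact: continuous_sin_fst| |exact: ccos|exact: cp].
by apply: cp; exact: continuous_sph.
Qed.

(** The divergence on the sphere of the tangential field k(x) (p - <x,p> x), that is,
    of k times the gradient of <x,p>, whose Laplacian is -2 <x,p>. *)
Definition sphere_div (x : E3 R) : R :=
  dot (K x) p - dot (K x) x * dot p x - k x * dot p x *+ 2.

Let divE (u : R * R) : sphere_div (sph u) * sin u.1 = divth u + divph u.
Proof.
by rewrite /sphere_div /divth /divph -dot_frame; ring.
Qed.

Lemma continuous_sphere_div : continuous (fun u => sphere_div (sph u) * sin u.1).
Proof.
rewrite (_ : (fun u => _) = (fun u => divth u + divph u)); last exact/funext/divE.
by move=> u; apply: (@continuous_at_add R (R * R)%type);
  [exact: cdivth|exact: cdivph].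
Qed.

(** Divergence theorem.  There are no boundary terms: the factor sin theta kills
    them at the poles, and the field is periodic in phi. *)
Lemma integral_sphere_div : (\int[lam2]_(u in sph_box)
  (sphere_div (sph u) * sin u.1)%:E = 0)%E.
Proof.
under eq_integral do rewrite divE EFinD.
rewrite integralD//=;
  [|exact: measurable_sph_box|exact: continuous_integrable_sph_box..].
rewrite (integral_box_fst cdivth dth) ?(integral_box_snd cdivph dph) ?adde0//.
- move=> x; congr (k _ * dot p _).
    by rewrite /sph/= sin0 cos0 sin2pi cos2pi.
  by rewrite /e_phi/= sin0 cos0 sin2pi cos2pi.
- by move=> y; rewrite sin0 sinpi !mul0r.
Qed.

End potential_field.

End divergence.

(** * The weight and the field as functions of the dot product *)

Section one_variable.
Context {R : realType}.

(** ln (2 e^2 / v).  It is at least 1 for v <= 3, the range of 1 +- <x,p> + e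
    for e <= 1; the value 2 e^2 is the one that makes [inv_rho_phi_le] true up
    to r = pi. *)
Definition ell (v : R) : R := ln 2 + 2 - ln v.

(** Size of the field attached to one pole, relative to the gradient of <x,p>. *)
Definition pole_coef (v : R) : R := (2 * v * ell v)^-1.

Definition dpole_coef (v : R) : R := - ((ell v - 1) / (2 * (v * ell v) ^+ 2)).

Definition pole_weight (e u : R) : R := u / (2 * ((u + e) * ell (u + e)) ^+ 2).

Lemma ell_ge1 (v : R) : 0 < v -> v <= 3 -> 1 <= ell v.
Proof.
move=> v0 v3; rewrite /ell.
have e2 : 2 <= expR 1 :> R by have := expR_ge1Dx (1:R); lra.
suff : ln v <= ln (2 * expR 1).
  rewrite lnM ?posrE ?expR_gt0// expRK; lra.
by rewrite ler_ln ?posrE// ?mulr_gt0 ?expR_gt0//; lra.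
Qed.

Let ell_neq0 (v : R) : 0 < v -> v <= 3 -> ell v != 0.
Proof. by move=> v0 v3; rewrite gt_eqF// (@lt_le_trans _ _ 1)// ell_ge1. Qed.

Lemma is_derive_pole_coef (v : R) : 0 < v -> ell v != 0 ->
  is_derive v 1 pole_coef (dpole_coef v).
Proof.
move=> v0 l0; rewrite /pole_coef.
have v_n0 : v != 0 by rewrite gt_eqF.
have dl : is_derive v 1 ell (0 + - v^-1) :=
  is_derive_add (is_derive_const _ _) (is_derive_opp (is_derive1_ln v0)).
have d1 := is_derive_mul (is_derive_mul (is_derive_const 2 v)
  (is_derive_id v 1)) dl.
have h0 : 2 * v * ell v != 0 by rewrite !mulf_neq0.
have d2 := is_derive_inv (f := fun t => 2 * t * ell t) h0 d1.
apply: (is_derive_eq d2).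
rewrite /dpole_coef /=; set l := ell v in l0 *.
by field; rewrite v_n0 l0.
Qed.

(** The inequality div X - |X|^2 >= W - 5/4 for the field of a single pole, at the
    point where 1 - <x,p> = u. Over the common denominator (v l)^2, with v = u + e, the
    difference of the two sides is
      e l - u^2/4 + u^2 l/2 - u v l + (5/4) v^2 l^2,
    and both u^2 and u v l are at most v^2 l^2 because l >= 1. *)
Lemma pole_coef_ineq (e u : R) : 0 < e <= 1 -> 0 <= u <= 2 ->
  pole_weight e u - 5 / 4 <=
  dpole_coef (u + e) * (u * (2 - u)) + 2 * (1 - u) * pole_coef (u + e)
    - pole_coef (u + e) ^+ 2 * (u * (2 - u)).
Proof.
move=> /andP[e0 e1] /andP[u0 u2].
have v0 : 0 < u + e by lra.
have l1 : 1 <= ell (u + e) by apply: ell_ge1 => //; lra.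
rewrite /pole_weight /pole_coef /dpole_coef; set l := ell (u + e) in l1 *.
have l0 : 0 < l by lra.
have vl0 : 0 < ((u + e) * l) ^+ 2 by rewrite exprn_gt0// mulr_gt0.
rewrite -subr_ge0.
have -> : - ((l - 1) / (2 * ((u + e) * l) ^+ 2)) * (u * (2 - u)) +
   2 * (1 - u) * (2 * (u + e) * l)^-1 - (2 * (u + e) * l)^-1 ^+ 2 * (u * (2 - u)) -
   (u / (2 * ((u + e) * l) ^+ 2) - 5 / 4) =
   (e * l - u ^+ 2 / 4 + u ^+ 2 * l / 2 - u * (u + e) * l
     + 5 / 4 * ((u + e) * l) ^+ 2) / ((u + e) * l) ^+ 2.
  by field; rewrite !gt_eqF.
apply: divr_ge0; last exact: ltW.
have uv : u <= (u + e) * l by nra.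
have uv2 : u ^+ 2 <= ((u + e) * l) ^+ 2 by rewrite ler_sqr ?nnegrE ?mulr_ge0//; lra.
have uvl : u * (u + e) * l <= ((u + e) * l) ^+ 2.
  by rewrite expr2 -mulrA ler_wpM2r// mulr_ge0//; lra.
have : 0 <= e * l by rewrite mulr_ge0//; lra.
have : 0 <= u ^+ 2 * l by rewrite mulr_ge0 ?sqr_ge0//; lra.
lra.
Qed.

(** The total field is [field_coef e <x,p>] times the gradient of <x,p>; the pole -p
    enters with the opposite sign, since <x,-p> = - <x,p>. *)
Definition field_coef (e s : R) : R :=
  pole_coef (1 + s + e) - pole_coef (1 - s + e).

Definition dfield_coef (e s : R) : R :=
  dpole_coef (1 + s + e) + dpole_coef (1 - s + e).

Definition hardy_weight (e s : R) : R :=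
  pole_weight e (1 - s) + pole_weight e (1 + s).

(** The right-hand side is div X - |X|^2 for the total field. The two
    one-pole fields have opposite directions, so -|X|^2 exceeds the sum of their
    contributions by twice the product of their sizes. *)
Lemma field_coef_ineq (e s : R) : 0 < e <= 1 -> -1 <= s <= 1 ->
  hardy_weight e s - 5 / 2 <=
  dfield_coef e s * (1 - s ^+ 2) - 2 * s * field_coef e s
    - field_coef e s ^+ 2 * (1 - s ^+ 2).
Proof.
move=> e01 /andP[s1 s2]; have /andP[e0 e1] := e01.
have h1 := @pole_coef_ineq e (1 - s) e01; have h2 := @pole_coef_ineq e (1 + s) e01.
have {h1} := h1 ltac:(lra).
have {h2} := h2 ltac:(lra).
have p1 : 0 <= pole_coef (1 - s + e).
  rewrite invr_ge0 mulr_ge0// ?mulr_ge0//; first lra.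
  by apply: (@le_trans _ _ 1) => //; apply: ell_ge1; lra.
have p2 : 0 <= pole_coef (1 + s + e).
  rewrite invr_ge0 mulr_ge0// ?mulr_ge0//; first lra.
  by apply: (@le_trans _ _ 1) => //; apply: ell_ge1; lra.
have : 0 <= pole_coef (1 - s + e) * pole_coef (1 + s + e) * (1 - s ^+ 2).
  by rewrite mulr_ge0 ?mulr_ge0//; nra.
rewrite /hardy_weight /field_coef /dfield_coef.
set a := pole_coef (1 - s + e); set b := pole_coef (1 + s + e).
set da := dpole_coef _; set db := dpole_coef _.
nra.
Qed.

Lemma is_derive_field_coef (e s : R) : 0 < e <= 1 -> -1 <= s <= 1 ->
  is_derive s 1 (field_coef e) (dfield_coef e s).
Proof.
move=> /andP[e0 e1] /andP[s1 s2].
have dp : is_derive s 1 (fun s => 1 + s + e) (0 + 1 + 0).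
  exact: (is_derive_add (is_derive_add (is_derive_const 1 s) (is_derive_id s 1))
    (is_derive_const e s)).
have dm : is_derive s 1 (fun s => 1 - s + e) (0 + - 1 + 0).
  exact: (is_derive_add (is_derive_add (is_derive_const 1 s)
    (is_derive_opp (is_derive_id s 1))) (is_derive_const e s)).
have h1 : is_derive (1 + s + e) 1 pole_coef (dpole_coef (1 + s + e)).
  by apply: is_derive_pole_coef; [lra|apply: ell_neq0; lra].
have h2 : is_derive (1 - s + e) 1 pole_coef (dpole_coef (1 - s + e)).
  by apply: is_derive_pole_coef; [lra|apply: ell_neq0; lra].
have c1 := @is_derive1_comp _ pole_coef (fun s => 1 + s + e) _ _ _ h1 dp.
have c2 := @is_derive1_comp _ pole_coef (fun s => 1 - s + e) _ _ _ h2 dm.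
rewrite (_ : dfield_coef e s = dpole_coef (1 + s + e) * (0 + 1 + 0) -
                       dpole_coef (1 - s + e) * (0 + - 1 + 0)).
  exact: (is_derive_add c1 (is_derive_opp c2)).
by rewrite /dfield_coef; ring.
Qed.

Lemma pole_weight_ge0 e u : 0 <= u -> 0 <= pole_weight e u.
Proof. by move=> u0; rewrite divr_ge0// mulr_ge0// sqr_ge0. Qed.

Lemma pole_weight_le e u : 0 < e <= 1 -> 0 <= u <= 2 -> pole_weight e u <= e^-1.
Proof.
move=> /andP[e0 e1] /andP[u0 u2].
have l1 : 1 <= ell (u + e) by apply: ell_ge1; lra.
have v0 : 0 < u + e by lra.
have vl : u + e <= (u + e) * ell (u + e) by rewrite ler_peMr// ltW.
have : (u + e) ^+ 2 <= ((u + e) * ell (u + e)) ^+ 2 by rewrite ler_sqr ?nnegrE; lra.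
rewrite /pole_weight; set X := _ ^+ 2 => hX.
rewrite ler_pdivrMr; last by nra.
rewrite mulrC ler_pdivlMr//; nra.
Qed.

Lemma continuous_ell v : 0 < v -> {for v, continuous ell}.
Proof.
move=> v0; apply: (@continuous_at_sub _ R); first exact: cst_continuous.
exact: continuous_ln.
Qed.

Lemma continuous_dpole_coef v : 0 < v -> ell v != 0 ->
  {for v, continuous dpole_coef}.
Proof.
move=> v0 l0; have cl := continuous_ell v0.
apply: continuousN; apply: (@continuous_at_mul _ R).
  by apply: (@continuous_at_sub _ R) => //; exact: cst_continuous.
apply: continuousV; first by rewrite mulf_neq0// expf_neq0// mulf_neq0// gt_eqF.
apply: (@continuous_at_mul _ R); first exact: cst_continuous.
by apply: (@continuous_at_mul _ R); apply: (@continuous_at_mul _ R) => //;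
  exact: cvg_id.
Qed.

Let continuous_weight_den (v : R) : 0 < v -> ell v != 0 ->
  {for v, continuous (fun v : R => (2 * (v * ell v) ^+ 2)^-1)}.
Proof.
move=> v0 l0; have cl := continuous_ell v0.
apply: (@continuousV _ R); first by rewrite mulf_neq0// expf_neq0// mulf_neq0//
  gt_eqF.
apply: (@continuous_at_mul _ R); first exact: cst_continuous.
by apply: (@continuous_at_mul _ R); apply: (@continuous_at_mul _ R) => //;
  exact: cvg_id.
Qed.

Lemma continuous_pole_weight (e u : R) : 0 < u + e -> ell (u + e) != 0 ->
  {for e, continuous (pole_weight ^~ u)} /\ {for u, continuous (pole_weight e)}.
Proof.
move=> v0 l0; split; rewrite /pole_weight.
  apply: (@continuous_at_mul _ R); first exact: cst_continuous.
  apply: (@continuous_comp _ _ _ (fun e => u + e)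
    (fun v : R => (2 * (v * ell v) ^+ 2)^-1));
    last exact: continuous_weight_den.
  by apply: (@continuous_at_add _ R); [exact: cst_continuous|exact: cvg_id].
apply: (@continuous_at_mul _ R); first exact: cvg_id.
apply: (@continuous_comp _ _ _ (fun u => u + e)
  (fun v : R => (2 * (v * ell v) ^+ 2)^-1));
  last exact: continuous_weight_den.
by apply: (@continuous_at_add _ R); [exact: cvg_id|exact: cst_continuous].
Qed.

Let cplus (e s : R) : {for s, continuous (fun s : R => 1 + s + e)}.
Proof.
apply: (@continuous_at_add _ R); last exact: cst_continuous.
by apply: (@continuous_at_add _ R); [exact: cst_continuous|exact: cvg_id].
Qed.

Let cminus (e s : R) : {for s, continuous (fun s : R => 1 - s + e)}.
Proof.
apply: (@continuous_at_add _ R); last exact: cst_continuous.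
by apply: (@continuous_at_sub _ R); [exact: cst_continuous|exact: cvg_id].
Qed.

Lemma continuous_field_coef (e s : R) : 0 < e <= 1 -> -1 <= s <= 1 ->
  {for s, continuous (field_coef e)}.
Proof.
move=> e01 s1; have h := is_derive_field_coef e01 s1.
by apply: differentiable_continuous; apply/derivable1_diffP; exact: ex_derive.
Qed.

Lemma continuous_dfield_coef (e s : R) : 0 < e <= 1 -> -1 <= s <= 1 ->
  {for s, continuous (dfield_coef e)}.
Proof.
move=> /andP[e0 e1] /andP[s1 s2]; rewrite /dfield_coef;
  apply: (@continuous_at_add _ R).
  apply: (@continuous_comp R R R (fun s : R => 1 + s + e) dpole_coef);
    first exact: cplus.
  by apply: continuous_dpole_coef; [lra|apply: ell_neq0; lra].
apply: (@continuous_comp R R R (fun s : R => 1 - s + e) dpole_coef);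
  first exact: cminus.
by apply: continuous_dpole_coef; [lra|apply: ell_neq0; lra].
Qed.

Lemma continuous_hardy_weight (e s : R) : 0 < e <= 1 -> -1 <= s <= 1 ->
  {for s, continuous (hardy_weight e)}.
Proof.
move=> /andP[e0 e1] /andP[s1 s2]; rewrite /hardy_weight;
  apply: (@continuous_at_add _ R).
  apply: (@continuous_comp R R R (fun s : R => 1 - s) (pole_weight e)).
    by apply: (@continuous_at_sub _ R); [exact: cst_continuous|exact: cvg_id].
  by apply: (continuous_pole_weight _ _).2; [lra|apply: ell_neq0; lra].
apply: (@continuous_comp R R R (fun s : R => 1 + s) (pole_weight e)).
  by apply: (@continuous_at_add _ R); [exact: cst_continuous|exact: cvg_id].
by apply: (continuous_pole_weight _ _).2; [lra|apply: ell_neq0; lra].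
Qed.

Lemma hardy_weight_ge0 e s : -1 <= s <= 1 -> 0 <= hardy_weight e s.
Proof. by move=> /andP[s1 s2]; apply: addr_ge0; apply: pole_weight_ge0; lra. Qed.

Lemma hardy_weight_le e s : 0 < e <= 1 -> -1 <= s <= 1 -> hardy_weight e s <= 2 / e.
Proof.
move=> e01 /andP[s1 s2]; rewrite mulr2n mulrDl mul1r.
by apply: lerD; apply: pole_weight_le => //; lra.
Qed.

Lemma cvg_hardy_weight s : -1 < s < 1 ->
  hardy_weight n.+1%:R^-1 s @[n --> \oo] --> hardy_weight 0 s.
Proof.
move=> /andP[s1 s2].
have c : {for 0, continuous (fun e => hardy_weight e s)}.
  apply: (@continuous_at_add _ R).
    by apply: (continuous_pole_weight _ _).1; [lra|apply: ell_neq0; lra].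
  by apply: (continuous_pole_weight _ _).1; [lra|apply: ell_neq0; lra].
apply: (@cvg_comp _ _ _ (fun n => n.+1%:R^-1)
  (fun e => hardy_weight e s) _ (nbhs (0:R))); last exact: c.
apply/cvgrPdist_le => e e0; near=> n.
rewrite sub0r normrN ger0_norm ?invr_ge0//; apply: ltW.
by near: n; exact: (near_infty_natSinv_lt (PosNum e0)).
Unshelve. all: by end_near. Qed.

Lemma measurable_hardy_weight (e : R) (p : E3 R) : 0 < e <= 1 -> S2 p ->
  measurable_fun S2 (fun x : E3 R => hardy_weight e (dot x p)).
Proof.
move=> e01 hp.
have -> : (fun x : E3 R => hardy_weight e (dot x p))
  = hardy_weight e \o (fun x => dot x p) by [].
have := measurable_comp (F := (`[-1, 1]%classic : set R)) (E := S2)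
  (f := hardy_weight e) (g := fun x : E3 R => dot x p); apply.
- exact: measurable_itv.
- move=> _ [x xS <-] /=; rewrite in_itv/=; exact: dot_S2_bound.
- apply: subspace_continuous_measurable_fun; first exact: measurable_itv.
  apply: continuous_in_subspaceT => s; rewrite inE/= in_itv/= => s1.
  exact: continuous_hardy_weight.
- exact: measurable_funTS (measurable_dot p).
Qed.

End one_variable.

(** * Comparison with the geodesic weights *)

Section geodesic_weights.
Context {R : realType}.

Lemma sin_le (x : R) : 0 <= x -> sin x <= x.
Proof.
rewrite le_eqVlt => /predU1P[<-|x0]; first by rewrite sin0.
have [c _] := MVT x0 (fun c _ => is_derive_sin c)
  (continuous_subspaceT (@continuous_sin R)).
rewrite sin0 !subr0 => ->.
by rewrite ler_piMl ?cos_le1// ltW.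
Qed.

(** Jordan's inequality. By the mean value theorem, sin x / x and
    (1 - sin x) / (pi/2 - x) are values cos c and cos d with c < x < d, and cos
    decreases. *)
Lemma sin_ge_chord (x : R) : 0 <= x <= pi / 2 -> x * (2 / pi) <= sin x.
Proof.
move=> /andP[]; have pi0 := @pi_gt0 R.
rewrite le_eqVlt => /predU1P[<- _|x0]; first by rewrite sin0 mul0r.
rewrite le_eqVlt => /predU1P[->|x2].
  have e (a : R) : a != 0 -> a / 2 * (2 / a) = 1 by move=> a0; field.
  by rewrite sin_pihalf e// gt_eqF.
have [c] := MVT x0 (fun c _ => is_derive_sin c)
  (continuous_subspaceT (@continuous_sin R)).
have [d] := MVT x2 (fun c _ => is_derive_sin c)
  (continuous_subspaceT (@continuous_sin R)).
rewrite !in_itv/= sin_pihalf sin0 !subr0 => /andP[xd d2] hd /andP[c0 cx] hc.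
have cd : cos d <= cos c.
  by rewrite ltW// ltr_cos ?in_itv/=; lra.
have alg (P a b s : R) : 1 - s = b * (P - x) -> s = a * x ->
    P * s - x = x * (P - x) * (a - b).
  move=> h1 h2; have -> : P * s - x = s * (P - x) - x * (1 - s) by ring.
  by rewrite h1 h2; ring.
have := alg _ _ _ _ hd hc.
have : 0 <= x * (pi / 2 - x) * (cos c - cos d) by rewrite !mulr_ge0//; lra.
move=> h1 h2; rewrite mulrA ler_pdivrMr//; lra.
Qed.

(** With u = 1 - cos t = 2 sin^2 (t/2), the bounds t / pi <= sin (t/2) <= t/2 give
    2 u <= t^2 and 2 t^2 <= pi^2 u; the latter says that
    ln (2 e^2 / u) <= 2 ln (pi e / t). *)
Lemma inv_rho_phi_le (t : R) : 0 < t < pi ->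
  (4 * rho phi t ^+ 2)^-1 <= pole_weight 0 (1 - cos t) /\ 0 < rho phi t.
Proof.
move=> /andP[t0 tpi]; have pi0 := @pi_gt0 R.
set u := 1 - cos t.
have uE : u = 2 * sin (t / 2) ^+ 2.
  rewrite /u {1}(_ : t = (t / 2) *+ 2); last by rewrite mulr2n; lra.
  rewrite cos_mulr2n cos2sin2; ring.
have s1 : sin (t / 2) <= t / 2 by apply: sin_le; lra.
have s2 : t / pi <= sin (t / 2).
  by have := @sin_ge_chord (t / 2) ltac:(lra); congr (_ <= _); field; lra.
have s0 : 0 < t / pi by rewrite divr_gt0.
have u1 : 2 * u <= t ^+ 2 by rewrite uE; nra.
have u2 : 2 * t ^+ 2 <= pi ^+ 2 * u.
  have : (t / pi) ^+ 2 <= sin (t / 2) ^+ 2 by rewrite ler_sqr ?nnegrE; lra.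
  rewrite expr_div_n ler_pdivrMr ?exprn_gt0// uE; lra.
have u0 : 0 < u by nra.
have u_le2 : u <= 2 by rewrite /u; have := cos_geN1 t; lra.
have l1 : 1 <= ell u by apply: ell_ge1; lra.
have phiE : phi t = ln pi + 1 - ln t.
  rewrite /phi lnM ?posrE ?mulr_gt0 ?invr_gt0 ?expR_gt0//.
  by rewrite lnM ?posrE ?expR_gt0// expRK lnV ?posrE.
have l2 : ell u <= 2 * phi t.
  rewrite phiE /ell.
  have : ln (2 * t ^+ 2) <= ln (pi ^+ 2 * u).
    by rewrite ler_ln// posrE mulr_gt0// exprn_gt0.
  by rewrite !lnM ?posrE ?exprn_gt0//; lra.
have p0 : 0 < phi t by lra.
split; last by rewrite mulr_gt0.
rewrite /pole_weight addr0 -[leRHS]invrK lef_pV2 ?posrE; last 2 first.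
- by rewrite mulr_gt0// exprn_gt0// mulr_gt0.
- by rewrite invr_gt0 divr_gt0// mulr_gt0// exprn_gt0// mulr_gt0//; lra.
rewrite invf_div /rho.
have -> : 2 * (u * ell u) ^+ 2 / u = 2 * u * ell u ^+ 2 by field; lra.
have : ell u ^+ 2 <= (2 * phi t) ^+ 2 by rewrite ler_sqr ?nnegrE; lra.
have : 0 <= phi t ^+ 2 by rewrite sqr_ge0.
have : 0 <= ell u ^+ 2 by rewrite sqr_ge0.
rewrite !exprMn; move: u1.
set A := t ^+ 2; set B := phi t ^+ 2; set C := ell u ^+ 2 => hA hC hB hD.
have : 2 * u * C <= A * C by apply: ler_wpM2r.
have : A * C <= A * (2 ^+ 2 * B) by apply: ler_wpM2l => //; exact: sqr_ge0.
lra.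
Qed.

Lemma phi_le_psi (t : R) : 0 < t < pi -> phi t <= psi t.
Proof.
move=> /andP[t0 tpi].
have st : sin t <= t by apply: sin_le; exact: ltW.
have s0 : 0 < sin t by apply: sin_gt0_pi; rewrite t0.
rewrite /psi /phi ler_ln ?posrE ?divr_gt0 ?mulr_gt0 ?pi_gt0 ?expR_gt0//.
by rewrite ler_wpM2l ?mulr_ge0 ?pi_ge0 ?expR_ge0// lef_pV2.
Qed.

Lemma rho_le_hardy_weight (chi : R -> R) (s a : R) : -1 < s < 1 ->
  (forall t, 0 < t < pi -> phi t <= chi t) ->
  a ^+ 2 / rho chi (acos s) ^+ 2 + a ^+ 2 / rho chi (pi - acos s) ^+ 2 <=
  4 * (hardy_weight 0 s * a ^+ 2).
Proof.
move=> /andP[s1 s2] hchi.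
have key t : 0 < t < pi -> a ^+ 2 / rho chi t ^+ 2
  <= 4 * (pole_weight 0 (1 - cos t) * a ^+ 2).
  move=> t01; have [hw0 r0] := inv_rho_phi_le t01.
  have /andP[t0 _] := t01.
  have rr : rho phi t <= rho chi t by apply: ler_wpM2l; [exact: ltW|exact: hchi].
  have r2 : 0 < rho phi t ^+ 2 by rewrite exprn_gt0.
  have rr2 : rho phi t ^+ 2 <= rho chi t ^+ 2
    by rewrite ler_sqr// nnegrE ltW// (lt_le_trans r0).
  rewrite mulrC mulrA ler_wpM2r ?sqr_ge0//.
  have : (rho chi t ^+ 2)^-1 <= (rho phi t ^+ 2)^-1.
    by rewrite lef_pV2// posrE (lt_le_trans r2).
  by move: hw0; rewrite invfM; lra.
have t0 : 0 < acos s by rewrite acos_gt0// ltW.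
have tpi : acos s < pi by rewrite acos_ltpi// s1 ltW.
have ca : cos (acos s) = s by rewrite acosK// in_itv/= !ltW.
have c2 : cos (pi - acos s) = - s.
  by rewrite cosB cospi sinpi mul0r addr0 mulN1r ca.
have := key (acos s); rewrite t0 tpi ca => /(_ isT) k1.
have := key (pi - acos s); rewrite c2 opprK subr_gt0 tpi /=.
rewrite gtrBl t0 => /(_ isT) k2.
by rewrite /hardy_weight; lra.
Qed.

End geodesic_weights.

(** * The Hardy inequality for smooth functions *)

Section smooth_hardy.
Context {R : realType}.
Let lam := @lebesgue_measure R.
Let lam2 := (lam \x lam)%E.

Section smooth_function.
Context (F : E3 R -> R) (p : E3 R) (e : R).
Hypotheses (sF : smooth F) (hp : S2 p) (e01 : 0 < e <= 1).

Let dF x : differentiable F x. Proof. exact: (sF [::] x). Qed.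

Lemma continuous_grad : continuous (grad F).
Proof.
have c v : continuous (fun y => 'D_v F y).
  by move=> x; apply: differentiable_continuous; exact: (sF [:: v] x).
move=> x; rewrite /grad.
apply: (@continuous_pair (E3 R) (R * R)%type R
  (fun x => ('D_(1, 0, 0) F x, 'D_(0, 1, 0) F x)) (fun x => 'D_(0, 0, 1) F x));
  last exact: c.
by apply: continuous_pair; exact: c.
Qed.

Let cF : continuous F.
Proof. by move=> x; exact: differentiable_continuous. Qed.

Let k x := F x ^+ 2 * field_coef e (dot x p).

Let K x : E3 R := (2 * F x * field_coef e (dot x p)) *: grad F x
  + (F x ^+ 2 * dfield_coef e (dot x p)) *: p.

Let cdotp (x : E3 R) : {for x, continuous (fun x => dot x p)}.
Proof. by apply: continuous_dot; [exact: cvg_id|exact: cst_continuous]. Qed.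

Let comp_cont (g : R -> R) (x : E3 R) : {for dot x p, continuous g} ->
  {for x, continuous (fun x => g (dot x p))}.
Proof.
by move=> cg; apply: (@continuous_comp _ _ _ (fun x => dot x p) g) => //;
  exact: cdotp.
Qed.

Let F2cont (x : E3 R) : {for x, continuous (fun x => F x ^+ 2)}.
Proof. by rewrite (_ : (fun x => _) = (fun x => F x * F x))//;
  apply: continuous_at_mul; exact: cF. Qed.

Let kcont x : S2 x -> {for x, continuous k}.
Proof.
move=> xS; apply: continuous_at_mul; first exact: F2cont.
by apply: comp_cont; apply: continuous_field_coef => //; exact: dot_S2_bound.
Qed.

Let Kcont x : S2 x -> {for x, continuous K}.
Proof.
move=> xS; apply: (@continuousD _ (E3 R)).
  apply: (@continuousZ _ (E3 R)); last exact: continuous_grad.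
  apply: continuous_at_mul; first by apply: continuous_at_mul;
    [exact: cst_continuous|exact: cF].
  by apply: comp_cont; apply: continuous_field_coef => //; exact: dot_S2_bound.
apply: (@continuousZ _ (E3 R)); last exact: cst_continuous.
apply: continuous_at_mul; first exact: F2cont.
by apply: comp_cont; apply: continuous_dfield_coef => //; exact: dot_S2_bound.
Qed.

Let kK (c1 c2 c3 : R -> R) (t d1 d2 d3 : R) :
  is_derive t (1:R) c1 d1 -> is_derive t (1:R) c2 d2 -> is_derive t (1:R) c3 d3 ->
  S2 (c1 t, c2 t, c3 t) ->
  is_derive t (1:R) (fun t => k (c1 t, c2 t, c3 t))
    (dot (K (c1 t, c2 t, c3 t)) (d1, d2, d3)).
Proof.
move=> h1 h2 h3 cS; set x := (c1 t, c2 t, c3 t) in cS *.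
have hF := is_derive_along h1 h2 h3 (dF x).
have hd : is_derive t (1:R) (fun t => dot (c1 t, c2 t, c3 t) p)
    (dot (d1, d2, d3) p).
  have := is_derive_add (is_derive_add
    (is_derive_mul h1 (is_derive_const p.1.1 t))
    (is_derive_mul h2 (is_derive_const p.1.2 t)))
    (is_derive_mul h3 (is_derive_const p.2 t)).
  by rewrite !mulr0 !addr0.
have hh' := is_derive_field_coef e01 (dot_S2_bound cS hp).
have hc := @is_derive1_comp _ (field_coef e)
  (fun t => dot (c1 t, c2 t, c3 t) p) _ _ _ hh' hd.
have := is_derive_mul (is_derive_mul hF hF) hc.
rewrite (diff_grad _ (dF x)) => H.
rewrite /k; apply: (is_derive_eq H).
rewrite /K dotDl !dotZl (dotC (d1, d2, d3) p) /= -/x.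
have alg (a b c d f : R) :
  (a * f + f * a) * c + f * f * (d * b) = 2 * f * c * a + f ^+ 2 * d * b by ring.
exact: alg.
Qed.

(** Pointwise form of the argument: add F^2 times [field_coef_ineq] to the expansion
    of |sgrad F + F X|^2 >= 0. The terms in F <grad F, X> recombine with F^2 div X
    into div (F^2 X). *)
Lemma hardy_pointwise x : S2 x ->
  hardy_weight e (dot x p) * F x ^+ 2 <=
  dot (sgrad F x) (sgrad F x) + 5 / 2 * F x ^+ 2 + sphere_div p k K x.
Proof.
move=> xS; have s1 := dot_S2_bound xS hp.
have := field_coef_ineq e01 s1.
set s := dot x p in s1 *.
have F0 := sqr_ge0 (F x).
move/(ler_wpM2r F0).
have : 0 <= dot (sgrad F x + (F x * field_coef e s) *: (p - s *: x))
                (sgrad F x + (F x * field_coef e s) *: (p - s *: x)).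
  exact: dot_ge0.
have gx : dot (sgrad F x) x = 0.
  by rewrite /sgrad dotBl dotZl; move: xS; rewrite /S2/= => ->; rewrite mulr1 subrr.
have gp : dot (sgrad F x) p = dot (grad F x) p - dot (grad F x) x * s
  by rewrite /sgrad dotBl dotZl.
have pp : dot (p - s *: x) (p - s *: x) = 1 - s ^+ 2.
  rewrite dotBl dotZl !(dotC _ (p - _)) !dotBl !dotZl.
  move: xS hp; rewrite /S2/= -/s => -> ->; rewrite (dotC p x) -/s; ring.
rewrite dotDZ pp (dotC (sgrad F x) (p - _)) dotBl dotZl (dotC x) gx mulr0 subr0
  (dotC p) gp.
rewrite /sphere_div /K /k -/s !dotDl !dotZl (dotC p x) -/s.
move: (hp); rewrite {1}/S2/= => ->.
nra.
Qed.

Lemma continuous_sgrad : continuous (sgrad F).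
Proof.
move=> x; rewrite /sgrad; apply: (@continuousB R (E3 R) (E3 R) (grad F)
  (fun x => dot (grad F x) x *: x)); first exact: continuous_grad.
apply: (@continuousZ _ (E3 R)); last exact: cvg_id.
by apply: continuous_dot; [exact: continuous_grad|exact: cvg_id].
Qed.

Let csg : continuous (fun x => dot (sgrad F x) (sgrad F x)).
Proof. by move=> x; apply: continuous_dot; exact: continuous_sgrad. Qed.

Let mF2 : measurable_fun S2 (fun x => F x ^+ 2).
Proof. by apply: measurable_funTS; apply: continuous_measurable_R3;
  exact: F2cont. Qed.

Let msg : measurable_fun S2 (fun x => (dot (sgrad F x) (sgrad F x))%:E).
Proof.
by apply/measurable_EFinP; apply: measurable_funTS; exact: continuous_measurable_R3.
Qed.

Let mF2e : measurable_fun S2 (fun x => (F x ^+ 2)%:E).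
Proof. exact/measurable_EFinP. Qed.

Let cbox (g : E3 R -> R) : (forall x, S2 x -> {for x, continuous g}) ->
  continuous (fun u : R * R => g (sph u) * sin u.1).
Proof.
move=> cg u; apply: (@continuous_at_mul _ (R * R)%type);
  last exact: continuous_sin_fst.
apply: (@continuous_comp _ _ _ (@sph R : R * R -> E3 R) g);
  first exact: continuous_sph.
by apply: cg; exact: sph_S2.
Qed.

Let mbox (g : E3 R -> R) : (forall x, S2 x -> {for x, continuous g}) ->
  measurable_fun sph_box (fun u : measurableTypeR R * measurableTypeR R =>
    (g (sph u) * sin u.1)%:E).
Proof.
move=> cg; apply/measurable_EFinP; apply: measurable_funTS.
by apply: continuous_measurable_R2; exact: cbox.
Qed.

(** Integrate the pointwise inequality; the divergence integrates to zero. *)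
Lemma hardy_smooth :
  (\int[sigma]_(x in S2) (hardy_weight e (dot x p) * F x ^+ 2)%:E <=
   int_normsq (sgrad F) + (5 / 2)%:E * int_sq F)%E.
Proof.
have mS := @measurable_S2 R; have mB := @measurable_sph_box R.
have F20 x : 0 <= F x ^+ 2 by exact: sqr_ge0.
have w0 x : S2 x -> 0 <= hardy_weight e (dot x p).
  by move=> xS; apply: hardy_weight_ge0; exact: dot_S2_bound.
pose A x := dot (sgrad F x) (sgrad F x) + 5 / 2 * F x ^+ 2.
have A0 x : 0 <= A x by rewrite addr_ge0 ?dot_ge0// mulr_ge0.
have cA : continuous A.
  move=> x; apply: (@continuous_at_add R (E3 R)
    (fun x => dot (sgrad F x) (sgrad F x)) (fun x => 5 / 2 * F x ^+ 2)); first exact: csg.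
  by apply: (@continuous_at_mul R (E3 R) (fun=> 5 / 2) (fun x => F x ^+ 2));
    [exact: cst_continuous|exact: F2cont].
have -> : (int_normsq (sgrad F) + (5 / 2)%:E * int_sq F =
    \int[sigma]_(x in S2) (A x)%:E)%E.
  under [RHS]eq_integral => x _ do rewrite /A EFinD EFinM.
  rewrite ge0_integralD//=.
  - by rewrite ge0_integralZl// => x _; rewrite lee_fin.
  - by move=> x _; rewrite lee_fin dot_ge0.
  - by move=> x _; rewrite mule_ge0// lee_fin.
  - by apply: emeasurable_funM => //; exact: mF2e.
rewrite !ge0_integral_S2; last 4 first.
- by apply/measurable_EFinP; apply: measurable_funTS;
    exact: continuous_measurable_R3.
- by move=> x _; rewrite lee_fin.
- apply/measurable_EFinP.
  exact: (measurable_funM (measurable_hardy_weight e01 hp) mF2).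
- by move=> x xS; rewrite lee_fin; apply: mulr_ge0; [exact: w0|exact: F20].
have -> : (\int[lam2]_(u in sph_box) ((A (sph u))%:E * (sin u.1)%:E) =
   \int[lam2]_(u in sph_box) ((A (sph u) * sin u.1)%:E
     + (sphere_div p k K (sph u) * sin u.1)%:E))%E.
  rewrite integralD//.
  - by rewrite (integral_sphere_div p kK kcont Kcont) adde0.
  - by apply: continuous_integrable_sph_box; apply: cbox => x _; exact: cA.
  - exact: (continuous_integrable_sph_box (@continuous_sphere_div R p k K
      kcont Kcont)).
apply: ge0_le_integral => //.
- move=> u uB; rewrite -EFinM lee_fin; apply: mulr_ge0; last exact: sph_box_sin_ge0.
  by apply: mulr_ge0; [apply: w0; exact: sph_S2|exact: F20].
- apply: (@mbox (fun x => hardy_weight e (dot x p) * F x ^+ 2)) => x xS.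
  apply: continuous_at_mul; last exact: F2cont.
  by apply: comp_cont; apply: continuous_hardy_weight => //; exact: dot_S2_bound.
- apply: emeasurable_funD.
    by apply: (@mbox A) => x _; exact: cA.
  apply/measurable_EFinP; apply: measurable_funTS.
  apply: continuous_measurable_R2.
  exact: (@continuous_sphere_div R p k K kcont Kcont).
- move=> u uB; rewrite -EFinM -EFinD lee_fin -mulrDl ler_wpM2r ?sph_box_sin_ge0//.
  by apply: hardy_pointwise; exact: sph_S2.
Qed.

End smooth_function.

End smooth_hardy.

(** * Passage to the Sobolev space *)

Section sobolev.
Context {R : realType}.

(** The integral of a nonnegative function is a supremum over the simple functions
    below it, so monotonicity is an inclusion of sets of simple functions.  In this
    form it applies directly to the weights built from [acos]. *)
Lemma ge0_le_integral_any d (T : measurableType d) (mu : {measure set T -> \bar R})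
    (D : set T) (f g : T -> \bar R) :
  (forall x, D x -> 0 <= f x)%E -> (forall x, D x -> f x <= g x)%E ->
  (\int[mu]_(x in D) f x <= \int[mu]_(x in D) g x)%E.
Proof.
move=> f0 fg; rewrite integral_mkcond [leRHS]integral_mkcond.
have fg' x : ((f \_ D) x <= (g \_ D) x)%E.
  by rewrite !patchE; case: ifPn => // /[!inE] /fg.
rewrite !ge0_integralTE; last 2 first.
- by apply: erestrict_ge0 => x Dx; apply: (le_trans (f0 _ Dx)); exact: fg.
- by apply: erestrict_ge0.
apply: ereal_sup_le => _ [h hf <-]; exists h => // x.
exact: le_trans (hf x) (fg' x).
Qed.

(** (1 + d) b^2 + (1 + 1/d) c^2 - (b + c)^2 = (d b - c)^2 / d. *)
Lemma young_sqr (d a b : R) : 0 < d ->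
  a ^+ 2 <= (1 + d) * b ^+ 2 + (1 + d^-1) * (a - b) ^+ 2.
Proof.
move=> d0; rewrite -subr_ge0.
have -> : (1 + d) * b ^+ 2 + (1 + d^-1) * (a - b) ^+ 2 - a ^+ 2 =
   (d * b - (a - b)) ^+ 2 / d by field; rewrite gt_eqF.
by rewrite divr_ge0 ?sqr_ge0// ltW.
Qed.

Lemma young_dot (d : R) (a b : E3 R) : 0 < d ->
  dot a a <= (1 + d) * dot b b + (1 + d^-1) * dot (a - b) (a - b).
Proof.
move=> d0; have y := young_sqr _ _ d0.
have := y a.1.1 b.1.1; have := y a.1.2 b.1.2; have := y a.2 b.2.
by rewrite /dot /= -!expr2; lra.
Qed.

Lemma integral_S2_le_comb (A B C : E3 R -> R) (c1 c2 : R) :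
  0 <= c1 -> 0 <= c2 ->
  measurable_fun S2 B -> measurable_fun S2 C ->
  (forall x, S2 x -> 0 <= A x) -> (forall x, S2 x -> 0 <= B x) ->
  (forall x, S2 x -> 0 <= C x) ->
  (forall x, S2 x -> A x <= c1 * B x + c2 * C x) ->
  (\int[sigma]_(x in S2) (A x)%:E <=
   c1%:E * \int[sigma]_(x in S2) (B x)%:E +
   c2%:E * \int[sigma]_(x in S2) (C x)%:E)%E.
Proof.
move=> c10 c20 mB mC A0 B0 C0 ABC.
have mS := @measurable_S2 R.
have mB' : measurable_fun S2 (EFin \o B) by exact/measurable_EFinP.
have mC' : measurable_fun S2 (EFin \o C) by exact/measurable_EFinP.
have -> : (c1%:E * \int[sigma]_(x in S2) (B x)%:E
  + c2%:E * \int[sigma]_(x in S2) (C x)%:E =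
   \int[sigma]_(x in S2) (c1%:E * (B x)%:E + c2%:E * (C x)%:E))%E.
  rewrite ge0_integralD//=.
  - by rewrite !ge0_integralZl//.
  - by move=> x xS; rewrite mule_ge0// lee_fin B0.
  - by apply: emeasurable_funM.
  - by move=> x xS; rewrite mule_ge0// lee_fin C0.
  - by apply: emeasurable_funM.
apply: ge0_le_integral_any => x xS; first by rewrite lee_fin A0.
by rewrite -!EFinM -EFinD lee_fin ABC.
Qed.

Lemma measurable_dot_sub (G H : E3 R -> E3 R) : measurable_fun S2 G ->
  measurable_fun S2 H ->
  measurable_fun S2 (fun x => dot (G x - H x) (G x - H x)).
Proof.
move=> mG mH.
have -> : (fun x => dot (G x - H x) (G x - H x)) =
  (fun x => dot (G x) (G x) - 2 * dot (G x) (H x) + dot (H x) (H x)).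
  by apply/funext => x; rewrite /dot/=; ring.
apply: measurable_funD; last exact: measurable_fun_dot.
apply: measurable_funB; first exact: measurable_fun_dot.
by apply: measurable_funM => //; exact: measurable_fun_dot.
Qed.

Lemma measurable_sgrad (F : E3 R -> R) : smooth F -> measurable_fun S2 (sgrad F).
Proof.
move=> sF; apply: measurable_funTS.
have cs := continuous_sgrad sF.
have c1 (z : E3 R) : {for z, continuous (fun z : E3 R => z.1)} by exact: cvg_fst.
have c2 (z : E3 R) : {for z, continuous (fun z : E3 R => z.2)} by exact: cvg_snd.
apply/measurable_fun_pairP; split; first (apply/measurable_fun_pairP; split).
- apply: continuous_measurable_R3 => x.
  apply: (@continuous_comp _ _ _ (sgrad F) (fun z => z.1.1)); first exact: cs.
  by apply: (@continuous_comp _ _ _ fst fst); [exact: c1|exact: cvg_fst].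
- apply: continuous_measurable_R3 => x.
  apply: (@continuous_comp _ _ _ (sgrad F) (fun z => z.1.2)); first exact: cs.
  by apply: (@continuous_comp _ _ _ fst snd); [exact: c1|exact: cvg_snd].
- apply: continuous_measurable_R3 => x.
  by apply: (@continuous_comp _ _ _ (sgrad F) snd); [exact: cs|exact: c2].
Qed.

Lemma measurable_smooth (F : E3 R -> R) : smooth F -> measurable_fun S2 F.
Proof.
move=> sF; apply: measurable_funTS; apply: continuous_measurable_R3 => x.
by apply: differentiable_continuous; exact: (sF [::] x).
Qed.

(** Replacing f by F_n and back costs a factor 1 + d each time and errors that tend to
    zero with n, because the weight is bounded by 2 / e. Let n tend to infinity, then d
    to 0. *)
Lemma hardy_H1 (p : E3 R) (e : R) (f : E3 R -> R) (G : E3 R -> E3 R) :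
  S2 p -> 0 < e <= 1 -> H1 f G ->
  (\int[sigma]_(x in S2) (hardy_weight e (dot x p) * f x ^+ 2)%:E <=
   int_normsq G + (5 / 2)%:E * int_sq f)%E.
Proof.
move=> hp e01 [[mf ff] [mG fG] [F [sF cF cG]]].
have mw := measurable_hardy_weight e01 hp.
have w0 x : S2 x -> 0 <= hardy_weight e (dot x p).
  by move=> xS; apply: hardy_weight_ge0; exact: dot_S2_bound.
have wM x : S2 x -> hardy_weight e (dot x p) <= 2 / e.
  by move=> xS; apply: hardy_weight_le => //; exact: dot_S2_bound.
have e0 : 0 < e by case/andP: e01.
have mF n := measurable_smooth (sF n).
have mFf n : measurable_fun S2 (F n \- f) by exact: measurable_funB.
have isq_ge0 (g : E3 R -> R) : (0 <= int_sq g)%E.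
  by apply: integral_ge0 => x _; rewrite lee_fin sqr_ge0.
have nsq_ge0 (H : E3 R -> E3 R) : (0 <= int_normsq H)%E.
  by apply: integral_ge0 => x _; rewrite lee_fin dot_ge0.
pose I (g : E3 R -> R) := (\int[sigma]_(x in S2)
  (hardy_weight e (dot x p) * g x ^+ 2)%:E)%E.
rewrite -/(I f); set X := I f.
have step n (d : R) : 0 < d ->
  (X <= (1 + d)%:E * (((1 + d)%:E * int_normsq G +
                (1 + d^-1)%:E * int_normsq (fun x => (sgrad (F n) x - G x)%R)) +
             (5 / 2)%:E * ((1 + d)%:E * int_sq f +
                (1 + d^-1)%:E * int_sq (F n \- f)%R))
       + (1 + d^-1)%:E * ((2 / e)%:E * int_sq (F n \- f)%R))%E.
  move=> d0.
  have dp : 0 <= 1 + d by rewrite addr_ge0// ltW.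
  have dm : 0 <= 1 + d^-1 by rewrite addr_ge0// invr_ge0 ltW.
  have h1 : (X <= (1 + d)%:E * I (F n) + (1 + d^-1)%:E * I (F n \- f)%R)%E.
    apply: integral_S2_le_comb => //.
    - by apply: measurable_funM => //; exact: measurable_funX.
    - by apply: measurable_funM => //; exact: measurable_funX.
    - by move=> x xS; rewrite mulr_ge0 ?w0 ?sqr_ge0.
    - by move=> x xS; rewrite mulr_ge0 ?w0 ?sqr_ge0.
    - by move=> x xS; rewrite mulr_ge0 ?w0 ?sqr_ge0.
    - move=> x xS /=; have := ler_wpM2l (w0 x xS) (young_sqr (f x) (F n x) d0).
      move/le_trans; apply; rewrite le_eqVlt; apply/orP; left; apply/eqP; ring.
  apply: (le_trans h1); apply: leeD; apply: lee_wpmul2l; rewrite ?lee_fin//.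
    apply: (le_trans (hardy_smooth (sF n) hp e01)); apply: leeD.
      apply: integral_S2_le_comb => //.
      - exact: measurable_fun_dot.
      - by apply: measurable_dot_sub => //; exact: measurable_sgrad.
      - by move=> x _; exact: dot_ge0.
      - by move=> x _; exact: dot_ge0.
      - by move=> x _; exact: dot_ge0.
      - by move=> x _; exact: young_dot.
    apply: lee_wpmul2l; rewrite ?lee_fin//.
    apply: integral_S2_le_comb => //.
    - exact: measurable_funX.
    - exact: measurable_funX.
    - by move=> x _; exact: sqr_ge0.
    - by move=> x _; exact: sqr_ge0.
    - by move=> x _; exact: sqr_ge0.
    - by move=> x _; exact: young_sqr.
  have := @integral_S2_le_comb (fun x : E3 R =>
    hardy_weight e (dot x p) * (F n \- f) x ^+ 2) (fun x => (F n \- f) x ^+ 2)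
    (cst 0) (2 / e) 0.
  rewrite mul0e adde0; apply => //.
  - by rewrite divr_ge0// ltW.
  - exact: measurable_funX.
  - by move=> x xS; rewrite mulr_ge0 ?w0 ?sqr_ge0.
  - by move=> x xS; exact: sqr_ge0.
  - by move=> x xS; rewrite mul0r addr0 ler_wpM2r ?sqr_ge0 ?wM.
have Gfin : int_normsq G \is a fin_num by rewrite ge0_fin_numE.
have ffin : int_sq f \is a fin_num by rewrite ge0_fin_numE.
move: (int_normsq G) Gfin (nsq_ge0 G) step => [g| |]// _ g0 step.
move: (int_sq f) ffin (isq_ge0 f) step => [s| |]// _ s0 step.
rewrite !lee_fin in g0 s0.
have step2 (d : R) : 0 < d -> (X <= ((1 + d) ^+ 2 * (g + 5 / 2 * s))%:E)%E.
  move=> d0; apply/lee_addgt0Pr => r r0.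
  (* c is the total coefficient of the two error terms in step. *)
  pose c := (1 + d) * (1 + d^-1) * (1 + 5 / 2) + (1 + d^-1) * (2 / e).
  have di : 0 < d^-1 by rewrite invr_gt0.
  have ei : 0 < 2 / e by rewrite divr_gt0.
  have c0 : 0 < c by rewrite /c addr_gt0// !mulr_gt0//; lra.
  pose t := r / c.
  have t0 : 0 < t by rewrite divr_gt0.
  have /fine_cvgP[fin1 /cvgrPdist_le/(_ t t0) lim1] := cF.
  have /fine_cvgP[fin2 /cvgrPdist_le/(_ t t0) lim2] := cG.
  near \oo => n.
  have n1 : int_sq (F n \- f) \is a fin_num by near: n.
  have n2 : int_normsq (fun x => sgrad (F n) x - G x) \is a fin_num by near: n.
  have n3 : `|0 - fine (int_sq (F n \- f))| <= t by near: n.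
  have n4 : `|0 - fine (int_normsq (fun x => sgrad (F n) x - G x))| <= t by near: n.
  have := step n d d0.
  move: (int_sq _) n1 n3 => [x| |]// _; rewrite /= sub0r normrN => n3.
  move: (int_normsq _) n2 n4 => [y| |]// _; rewrite /= sub0r normrN => n4.
  have {}n3 := le_trans (ler_norm _) n3.
  have {}n4 := le_trans (ler_norm _) n4.
  move=> h; apply: (le_trans h).
  rewrite -!EFinM -!EFinD lee_fin -?EFinM -?EFinD.
  have -> : r = c * t by rewrite /t mulrCA mulfV ?gt_eqF// mulr1.
  have y' : (1 + d) * (1 + d^-1) * y <= (1 + d) * (1 + d^-1) * t.
    by rewrite ler_wpM2l// mulr_ge0//; lra.
  have x' : (1 + d) * (1 + d^-1) * x <= (1 + d) * (1 + d^-1) * t.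
    by rewrite ler_wpM2l// mulr_ge0//; lra.
  have x'' : (1 + d^-1) * (2 / e) * x <= (1 + d^-1) * (2 / e) * t.
    by rewrite ler_wpM2l// mulr_ge0//; lra.
  have -> : (1 + d) * ((1 + d) * g + (1 + d^-1) * y +
       5 / 2 * ((1 + d) * s + (1 + d^-1) * x)) +
     (1 + d^-1) * (2 / e * x) = (1 + d) ^+ 2 * (g + 5 / 2 * s) +
     ((1 + d) * (1 + d^-1) * y + 5 / 2 * ((1 + d) * (1 + d^-1) * x) +
      (1 + d^-1) * (2 / e) * x) by ring.
  rewrite lerD2l /c.
  have -> : ((1 + d) * (1 + d^-1) * (1 + 5 / 2) + (1 + d^-1) * (2 / e)) * t =
    (1 + d) * (1 + d^-1) * t + 5 / 2 * ((1 + d) * (1 + d^-1) * t) +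
    (1 + d^-1) * (2 / e) * t by ring.
  lra.
rewrite -EFinM -EFinD; apply/lee_addgt0Pr => r r0.
set E := g + 5 / 2 * s in step2 *.
have E0 : 0 <= E by rewrite /E; lra.
(* For d <= 1, (1 + d)^2 E <= E + 3 d E, so d = r / (r + 3 E + 1) is small enough. *)
pose q := r + 3 * E + 1.
have q0 : 0 < q by rewrite /q; lra.
apply: (le_trans (step2 (r / q) _)); first by rewrite divr_gt0.
rewrite -EFinD lee_fin.
have d1 : r / q <= 1 by rewrite ler_pdivrMr// mul1r /q; lra.
have d0 : 0 < r / q by rewrite divr_gt0.
have dq : r / q * q = r by rewrite divfK ?gt_eqF.
have dT : r / q * (3 * E) <= r.
  rewrite -[leRHS]dq ler_wpM2l ?(ltW d0)// /q; lra.
move: (r / q) d1 d0 dT => d d1 d0 dT.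
nra.
Unshelve. all: by end_near. Qed.

End sobolev.

(** * Removal of the regularization *)

Section limit.
Context {R : realType}.

Lemma limn_einf_le (u : (\bar R)^nat) (M : \bar R) : (forall n, u n <= M)%E ->
  (limn_einf u <= M)%E.
Proof.
move=> uM; rewrite limn_einf_lim; apply: lime_le; first exact: is_cvg_einfs.
apply: nearW => n; apply: le_trans (uM n).
by apply: ereal_inf_lbound; exists n => /=.
Qed.

Lemma dot_S2_minus_poles (x p : E3 R) : S2 p -> (S2 `\` [set p; (- p)%R]) x ->
  -1 < dot x p < 1.
Proof.
move=> hp [xS /not_orP[/= xp xNp]].
have /andP[h1 h2] := dot_S2_bound xS hp.
have hNp : S2 (- p) by move: hp; rewrite /S2 /dot/= !mulrNN.
apply/andP; split; rewrite lt_neqAle ?h1 ?h2 andbT; apply/eqP.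
- move=> h; apply: xNp; apply: dot_S2_eq1 => //.
  by rewrite -[RHS]opprK h /dot/=; ring.
- by move=> h; apply: xp; exact: dot_S2_eq1.
Qed.

Lemma measurable_S2_minus_poles (p : E3 R) : S2 p ->
  measurable (S2 `\` [set p; (- p)%R]).
Proof.
move=> hp.
have -> : S2 `\` [set p; (- p)%R] =
    S2 `&` (fun x => dot x p) @^-1` `]-1, 1[%classic.
  apply/seteqP; split=> x.
    by move=> xD; split; [exact: xD.1|rewrite /= in_itv/= dot_S2_minus_poles].
  move=> [xS /=]; rewrite in_itv/= => /andP[h1 h2]; split=> // -[] /= xp.
    by move: h2; rewrite xp; move: (hp); rewrite /S2/= => ->; rewrite ltxx.
  by move: h1; rewrite xp /dot/= !mulNr -!opprD; move: (hp);
    rewrite /S2/dot/= => ->; rewrite ltxx.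
apply: measurableI; first exact: measurable_S2.
rewrite -[X in measurable X]setTI; apply: measurable_dot => //.
Qed.

(** Away from p and -p the regularized weights converge to the weight with e = 0,
    which is at least 1/4 of the weight in the integrand of Q; Fatou's lemma
    concludes. *)
Lemma Q_le (p : E3 R) (f : E3 R -> R) (G : E3 R -> E3 R) (chi : R -> R) :
  S2 p -> H1 f G -> (forall t, 0 < t < pi -> phi t <= chi t) ->
  (Q p f chi <= T 10 f G)%E.
Proof.
move=> hp hf hchi.
have mD := measurable_S2_minus_poles hp; set D := _ `\` _ in mD.
have DS : D `<=` S2 by move=> x [].
pose h n x : R := 4 * (hardy_weight n.+1%:R^-1 (dot x p) * f x ^+ 2).
have e01 n : 0 < (n.+1%:R^-1 : R) <= 1.
  by rewrite invr_gt0 ltr0n/= invf_le1 ?ltr0n// ler1n.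
have w0 n x : S2 x -> 0 <= h n x.
  move=> xS; rewrite mulr_ge0// mulr_ge0 ?sqr_ge0// hardy_weight_ge0//;
    exact: dot_S2_bound.
have mf : measurable_fun S2 f by case: hf => -[].
have mw n : measurable_fun S2
    (fun x => hardy_weight n.+1%:R^-1 (dot x p) * f x ^+ 2).
  apply: measurable_funM; first exact: (measurable_hardy_weight (e01 n) hp).
  exact: measurable_funX.
have mh n : measurable_fun S2 (h n) by exact: measurable_funM.
have mS := @measurable_S2 R.
have hT n : (\int[sigma]_(x in D) (h n x)%:E <= 4%:E * T 10 f G)%E.
  apply: (@le_trans _ _ (\int[sigma]_(x in S2) (h n x)%:E)%E).
    apply: ge0_subset_integral => //; first exact/measurable_EFinP.
    by move=> x xS; rewrite lee_fin w0.
  under eq_integral => x _ do rewrite /h EFinM.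
  rewrite ge0_integralZl//.
  - apply: lee_wpmul2l; rewrite ?lee_fin// /T.
    have -> : 10 / 4 = 5 / 2 :> R by lra.
    exact: hardy_H1.
  - exact/measurable_EFinP.
  - move=> x xS; rewrite lee_fin mulr_ge0 ?sqr_ge0// hardy_weight_ge0//;
      exact: dot_S2_bound.
rewrite /Q; apply: (@le_trans _ _ ((4^-1)%:E * (4%:E * T 10 f G))%E); last first.
  by rewrite muleA -EFinM mulVf// mul1e.
apply: lee_wpmul2l; first by rewrite lee_fin.
rewrite -/D; apply: (@le_trans _ _ (\int[sigma]_(x in D) limn_einf
  (fun n => (h n x)%:E))%E).
  apply: ge0_le_integral_any => x xD.
    by rewrite lee_fin addr_ge0// divr_ge0 ?sqr_ge0.
  have s1 := dot_S2_minus_poles hp xD.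
  have c : (h n x)%:E @[n --> \oo] -->
      (4 * (hardy_weight 0 (dot x p) * f x ^+ 2))%:E.
    apply: cvg_EFin; first exact: nearW.
    apply: cvgM; first exact: cvg_cst.
    by apply: cvgM; [exact: cvg_hardy_weight|exact: cvg_cst].
  rewrite (cvg_limn_einf_sup c).1 lee_fin.
  exact: rho_le_hardy_weight.
apply: (@le_trans _ _ (limn_einf (fun n => \int[sigma]_(x in D) (h n x)%:E))%E).
  apply: fatou => //.
  - move=> n; apply/measurable_EFinP; exact: (measurable_funS mS DS).
  - by move=> n x /DS xS; rewrite lee_fin w0.
exact: limn_einf_le.
Qed.

End limit.

Theorem theorem1 (R : realType) (p : E3 R) (hp : S2 p) :
  exists A B : R, 0 < A /\ 0 < B /\
    forall (f : E3 R -> R) (G : E3 R -> E3 R), H1 f G ->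
      (Q p f phi <= T A f G)%E /\ (Q p f psi <= T B f G)%E.
Proof.
exists 10, 10; do 2 split => //; move=> f G hf; split; apply: Q_le => //.
exact: phi_le_psi.
Qed.
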